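(* Let $(X,x)$ be a pointed topological space and $k\in\mathbb{N}$. For an HPol$_*$-expansion $\mathbf{p}=(p_\lambda):(X,x)\to(\mathbf{X},\mathbf{x})=((X_\lambda,x_\lambda),p_{\lambda\lambda'},\Lambda)$ let $\mathbf{Sh^*}((S^k,* ),(X,x))=(Sh^*((S^k,* ),(X_\lambda,x_\lambda)),(p_{\lambda\lambda'})_*,\Lambda)$ and let $\mathbf{p}_*:Sh^*((S^k,* ),(X,x))\to\mathbf{Sh^*}((S^k,* ),(X,x))$ be the morphism with components $F^*\mapsto p_\lambda\circ F^*$. (a) If $(X,x)$ is movable and $\mathbf{p}:(X,x)\to(\mathbf{X},\mathbf{x})$ is an HPol$_*$-expansion with $(\mathbf{X},\mathbf{x})$ a movable inverse system such that $\mathbf{p}_*$ is an HPol$_*$-expansion, then $\check{\pi}_k^{*^{top}}(X,x)$ is a movable topological group. (b) If $\mathbf{p}:(X,x)\to(\mathbf{X},\mathbf{x})$ is an HPol$_*$-expansion such that $Sh^*((S^k,* ),(X_\lambda,x_\lambda))$ is a compact polyhedron for all $\lambda\in\Lambda$, then $\mathbf{p}_*$ is an HPol$_*$-expansion of $Sh^*((S^k,* ),(X,x))$, and therefore in this case movability of $(X,x)$ implies movability of $\check{\pi}_k^{*^{top}}(X,x)$.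
   Context: HTop$_*$ is the homotopy category of pointed topological spaces (pointed homotopy classes of pointed maps), HPol$_*$ its full subcategory of pointed spaces having the homotopy type of pointed polyhedra. Inverse systems are indexed by directed sets. Pro$^*$-category. For inverse systems $\mathbf{X}=(X_\lambda,p_{\lambda\lambda'},\Lambda)$, $\mathbf{Y}=(Y_\mu,q_{\mu\mu'},M)$ in a category $\mathcal{T}$, an $S^*$-morphism $(f,f^n_\mu):\mathbf{X}\to\mathbf{Y}$ consists of a function $f:M\to\Lambda$ and $\mathcal{T}$-morphisms $f^n_\mu:X_{f(\mu)}\to Y_\mu$ ($n\in\mathbb{N},\mu\in M$) such that for all $\mu\le\mu'$ there are $\lambda\ge f(\mu),f(\mu')$ and $n\in\mathbb{N}$ with $q_{\mu\mu'}f^{n'}_{\mu'}p_{f(\mu')\lambda}=f^{n'}_\mu p_{f(\mu)\lambda}$ for all $n'\ge n$. Two such, $(f,f^n_\mu)$ and $(f',f'^n_\mu)$, are equivalent if for each $\mu\in M$ there are $\lambda\ge f(\mu),f'(\mu)$ and $n\in\mathbb{N}$ with $f^{n'}_\mu p_{f(\mu)\lambda}=f'^{n'}_\mu p_{f'(\mu)\lambda}$ for all $n'\ge n$. Composition: $(g,g^n_\nu)(f,f^n_\mu)=(fg,\,g^n_\nu f^n_{g(\nu)})$. Pro$^*$-$\mathcal{T}$ has inverse systems as objects and equivalence classes $[(f,f^n_\mu)]$ as morphisms; pro-$\mathcal{T}$ is regarded as a subcategory by $f^n_\mu=f_\mu$ for all $n$. Expansions. An HPol$_*$-expansion of $(X,x)$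 is a morphism $\mathbf{p}=(p_\lambda):(X,x)\to(\mathbf{X},\mathbf{x})=((X_\lambda,x_\lambda),p_{\lambda\lambda'},\Lambda)$ in pro-HTop$_*$ with all $(X_\lambda,x_\lambda)$ in HPol$_*$ such that (E1) each morphism $h:(X,x)\to P$ of HTop$_*$ with $P$ in HPol$_*$ factors as $h=fp_\lambda$ for some $\lambda$ and $f:(X_\lambda,x_\lambda)\to P$; (E2) if $f_0,f_1:(X_\lambda,x_\lambda)\to P$, $P$ in HPol$_*$, satisfy $f_0p_\lambda=f_1p_\lambda$, then $f_0p_{\lambda\lambda'}=f_1p_{\lambda\lambda'}$ for some $\lambda'\ge\lambda$. Every pointed space has an HPol$_*$-expansion, unique up to a unique compatible isomorphism in pro-HPol$_*$. Pointed coarse shape category $Sh^*_*$. Objects: pointed spaces. A morphism $F^*:(X,x)\to(Y,y)$ is a class $\langle\mathbf{f}^*\rangle$ of pro$^*$-HPol$_*$ morphisms between HPol$_*$-expansions of $(X,x)$ and $(Y,y)$, morphisms for different expansions being identified when they correspond under the canonical isomorphisms. Composition is by representatives; $Sh^*((X,x),(Y,y))$ is the set of such morphisms. Morphisms of HTop$_*$ (e.g. $p_\lambda$, $p_{\lambda\lambda'}$) induce coarse shape morphisms, written with the same symbol in compositions; $(p_{\lambda\lambda'})_*(G^* )=p_{\lambda\lambda'}\circ G^*$. $Sh^*((Y,y),(X,x))$ carries the topology with basis $V^{F^*}_\lambda=\{G^*:p_\lambda\circ F^*=p_\lambda\circ G^*\}$, for $F^*\in Sh^*((Y,y),(X,x))$,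 $\lambda\in\Lambda$, where $\mathbf{p}$ is any HPol$_*$-expansion of $(X,x)$; it is independent of $\mathbf{p}$. Coarse shape groups. $\check\pi_k^{*^{top}}(X,x)$ is the space $Sh^*((S^k,* ),(X,x))$ with this topology and the group operation $F^*+G^*=\langle[(f^n_\lambda+g^n_\lambda)]\rangle$ induced by the operations of $\pi_k(X_\lambda,x_\lambda)$ on representatives $f^n_\lambda,g^n_\lambda:(S^k,* )\to(X_\lambda,x_\lambda)$; it is a topological group. As pointed spaces, the sets $Sh^*((S^k,* ),-)$ have the identity element as base point. Movability. An inverse system $(X_\lambda,p_{\lambda\lambda'},\Lambda)$ in HTop$_*$ is movable if every $\lambda\in\Lambda$ admits $\lambda'\ge\lambda$ such that for each $\lambda''\ge\lambda$ there is a morphism $r:X_{\lambda'}\to X_{\lambda''}$ of HTop$_*$ with $p_{\lambda\lambda''}\circ r=p_{\lambda\lambda'}$ in HTop$_*$. A pointed space is movable if it admits an HPol$_*$-expansion whose inverse system is movable. A movable topological group is a topological group whose underlying pointed space is movable. *)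

(* Defs.v *)
From HB Require Import structures.
From mathcomp Require Import all_boot all_order all_algebra finmap generic_quotient.
From mathcomp Require Import ring lra.
From mathcomp Require Import all_classical reals topology normedtype.

Set Implicit Arguments.
Unset Strict Implicit.
Unset Printing Implicit Defensive.

Import Order.TTheory GRing.Theory Num.Theory numFieldNormedType.Exports.
Local Open Scope classical_set_scope.
Local Open Scope quotient_scope.
Local Open Scope ring_scope.

Record ptmap (X Y : ptopologicalType) := PtMap {
  ptmap_fun :> X -> Y;
  ptmap_continuous : continuous ptmap_fun;
  ptmap_point : ptmap_fun point = point }.

HB.instance Definition _ X Y := gen_eqMixin (ptmap X Y).
HB.instance Definition _ X Y := gen_choiceMixin (ptmap X Y).

Lemma ptmapP X Y (f g : ptmap X Y) : f =1 g -> f = g.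
Proof.
case: f g => [f cf pf] [g cg pg] /= /funext fg; subst g.
by congr PtMap; exact: Prop_irrelevance.
Qed.

Definition ptid (X : ptopologicalType) : ptmap X X :=
  PtMap (fun x => @cvg_id _ (nbhs x)) erefl.

Lemma ptcomp_continuous X Y Z (g : ptmap Y Z) (f : ptmap X Y) : continuous (g \o f).
Proof. by move=> x; apply: continuous_comp; exact: ptmap_continuous. Qed.

Lemma ptcomp_point X Y Z (g : ptmap Y Z) (f : ptmap X Y) : (g \o f) point = point.
Proof. by rewrite /= !ptmap_point. Qed.

Definition ptcomp X Y Z (g : ptmap Y Z) (f : ptmap X Y) : ptmap X Z :=
  PtMap (@ptcomp_continuous X Y Z g f) (ptcomp_point g f).

Definition ptconst (X Y : ptopologicalType) : ptmap X Y :=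
  PtMap (@cst_continuous X Y point) erefl.

Section homotopy.
Variable R : realType.

Definition phomotopic (X Y : ptopologicalType) (f g : ptmap X Y) : Prop :=
  exists H : R * X -> Y,
    [/\ {within `[0, 1] `*` [set: X], continuous H},
        forall x, H (0, x) = f x,
        forall x, H (1, x) = g x &
        forall t : R, t \in `[0, 1] -> H (t, point) = point].

Lemma phomotopic_refl X Y (f : ptmap X Y) : phomotopic f f.
Proof.
exists (f \o snd); split => //=; last by move=> *; exact: ptmap_point.
apply: continuous_subspaceT => -[t x]; apply: continuous_comp; first exact: cvg_snd.
exact: ptmap_continuous.
Qed.

Lemma within_comp_continuous (S T U : topologicalType) (A : set S) (B : set T)
  (u : S -> T) (H : T -> U) : {within B, continuous H} ->
  continuous u -> (forall s, A s -> B (u s)) ->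
  {within A, continuous (H \o u)}.
Proof.
move=> cH cu AB; apply/subspace_sigL_continuousP.
move/subspace_sigL_continuousP : cH => cH.
pose v (s : A) : B := exist _ (u (set_val s)) (mem_set (AB _ (set_valP s))).
have cv : continuous v.
  apply/continuousP => W -[W' oW' <-].
  rewrite -comp_preimage.
  rewrite (_ : _ \o _ = u \o set_val) //.
  rewrite comp_preimage; exists (u @^-1` W') => //.
  by move/continuousP : cu; apply.
have -> : sigL A (H \o u) = sigL B H \o v by apply/funext => s.
by move=> s; apply: continuous_comp; [exact: cv|exact: cH].
Qed.

Lemma pair_continuous (S T U : topologicalType) (u : S -> T) (v : S -> U) :
  continuous u -> continuous v -> continuous (fun s => (u s, v s)).
Proof. by move=> cu cv s; apply: cvg_pair; [exact: cu|exact: cv]. Qed.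

Lemma affine_continuous (T : topologicalType) (u : T -> R) (a b : R) :
  continuous u -> continuous (fun t => a * u t + b).
Proof.
move=> cu t; apply: (@cvgD _ R^o); last exact: cvg_cst.
by apply: (@cvgM R); [exact: cvg_cst|exact: cu].
Qed.

Lemma fst_continuous (T U : topologicalType) : continuous (@fst T U).
Proof. by move=> z; exact: cvg_fst. Qed.

Lemma snd_continuous (T U : topologicalType) : continuous (@snd T U).
Proof. by move=> z; exact: cvg_snd. Qed.

Lemma reparam_continuous (T : topologicalType) (a b : R) :
  continuous (fun z : R * T => (a * z.1 + b, z.2)).
Proof.
apply: pair_continuous; last exact: snd_continuous.
by apply: affine_continuous; exact: fst_continuous.
Qed.

Lemma phomotopic_sym X Y (f g : ptmap X Y) : phomotopic f g -> phomotopic g f.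
Proof.
move=> [H [cH H0 H1 Hp]].
exists (H \o (fun z => (-1 * z.1 + 1, z.2))); split => /=.
- apply: within_comp_continuous cH _ _; first exact: reparam_continuous.
  move=> [t x] /= [+ _]; rewrite !in_itv/= => /andP[t0 t1].
  by split => //; rewrite mulN1r addrC subr_ge0 t1 gerBl.
- by move=> x; rewrite mulr0 add0r.
- by move=> x; rewrite mulr1 addNr.
- move=> t; rewrite /= in_itv/= => /andP[t0 t1]; apply: Hp.
  by rewrite in_itv/= mulN1r addrC subr_ge0 t1 gerBl.
Qed.

Lemma closed_le_comp (T : topologicalType) (u : T -> R) (a : R) :
  continuous u -> closed [set t | u t <= a].
Proof.
move=> cu; rewrite (_ : [set t | _] = u @^-1` [set r | r <= a]) //.
by move/continuous_closedP : cu; apply; exact: closed_le.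
Qed.

Lemma closed_ge_comp (T : topologicalType) (u : T -> R) (a : R) :
  continuous u -> closed [set t | a <= u t].
Proof.
move=> cu; rewrite (_ : [set t | _] = u @^-1` [set r | a <= r]) //.
by move/continuous_closedP : cu; apply; exact: closed_ge.
Qed.

Lemma within_ext (T U : topologicalType) (A : set T) (f g : T -> U) :
  (forall t, A t -> f t = g t) ->
  {within A, continuous f} -> {within A, continuous g}.
Proof.
move=> fg cf; apply: (subspace_eq_continuous _ cf) => t /set_mem At; exact: fg.
Qed.

Lemma phomotopic_trans X Y (f g h : ptmap X Y) :
  phomotopic f g -> phomotopic g h -> phomotopic f h.
Proof.
move=> [H [cH H0 H1 Hp]] [K [cK K0 K1 Kp]].
pose L (z : R * X) := if z.1 <= 2^-1 then H (2 * z.1 + 0, z.2) else K (2 * z.1 + -1, z.2).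
have h2 : (2 : R) * 2^-1 = 1 by rewrite divff// pnatr_eq0.
have hp : (0 : R) < 2^-1 by rewrite invr_gt0.
have lo01 t : 0 <= t -> t <= 2^-1 -> 2 * t + 0 \in `[(0 : R), 1].
  by move=> t0 t1; rewrite in_itv/=; apply/andP; split; lra.
have hi01 t : 2^-1 <= t -> t <= 1 -> 2 * t + -1 \in `[(0 : R), 1].
  by move=> t0 t1; rewrite in_itv/=; apply/andP; split; lra.
exists L; split.
- have -> : `[0 : R, 1] `*` [set: X] =
      [set z | z.1 \in `[0 : R, 2^-1]] `|` [set z | z.1 \in `[2^-1 : R, 1]].
    apply/seteqP; split => -[t x] /=; rewrite !in_itv/=.
      move=> [/andP[-> ->] _]; rewrite andbT /=.
      by case: (leP t 2^-1) => [|/ltW]; [left|right].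
    case=> /andP[t0 t1]; split => //.
      by rewrite t0 (le_trans t1)// invf_le1// ler1n.
    by rewrite t1 (le_trans _ t0)// ltW.
  have cf (a b : R) : closed [set z : R * X | z.1 \in `[a, b]].
    have -> : [set z : R * X | z.1 \in `[a, b]] = [set z | a <= z.1] `&` [set z | z.1 <= b].
      by apply/seteqP; split => -[t x] /=; rewrite in_itv/= => /andP.
    apply: closedI; [apply: closed_ge_comp|apply: closed_le_comp];
      move=> z; exact: cvg_fst.
  apply: withinU_continuous; [exact: cf|exact: cf| |].
  + apply: (@within_ext _ _ _ (H \o (fun z : R * X => (2 * z.1 + 0, z.2)))).
      by move=> [t x] /=; rewrite in_itv/= /L /= => /andP[_ ->].
    apply: within_comp_continuous cH _ _; first exact: reparam_continuous.
    move=> [t x] /=; rewrite !in_itv/= => /andP[t0 t1]; split => //.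
    by move: (lo01 t t0 t1); rewrite in_itv.
  + apply: (@within_ext _ _ _ (K \o (fun z : R * X => (2 * z.1 + -1, z.2)))).
      move=> [t x] /=; rewrite in_itv/= /L /= => /andP[t0 _].
      case: ifPn => // t1; have -> : t = 2^-1 by apply/le_anti; rewrite t0 t1.
      by rewrite h2 subrr addr0 K0 H1.
    apply: within_comp_continuous cK _ _; first exact: reparam_continuous.
    move=> [t x] /=; rewrite !in_itv/= => /andP[t0 t1]; split => //.
    by move: (hi01 t t0 t1); rewrite in_itv.
- by move=> x; rewrite /L /= ltW// mulr0 addr0.
- by move=> x; rewrite /L /= leNgt invf_lt1//= ltr1n/= mulr1 addrK.
- move=> t; rewrite /= in_itv/= /L/= => /andP[t0 t1]; case: ifPn => [th|].
    by apply: Hp; exact: lo01.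
  by rewrite -ltNge => /ltW th; apply: Kp; exact: hi01.
Qed.

Lemma phomotopic_comp X Y Z (f f' : ptmap X Y) (g g' : ptmap Y Z) :
  phomotopic f f' -> phomotopic g g' -> phomotopic (ptcomp g f) (ptcomp g' f').
Proof.
move=> [H [cH H0 H1 Hp]] [K [cK K0 K1 Kp]].
apply: (@phomotopic_trans _ _ _ (ptcomp g f')).
  exists (g \o H); split => /=.
  - apply: within_continuous_comp cH => z _; exact: ptmap_continuous.
  - by move=> x; rewrite H0.
  - by move=> x; rewrite H1.
  - by move=> t t01; rewrite Hp// ptmap_point.
exists (K \o (fun z => (z.1, f' z.2))); split => /=.
- apply: within_comp_continuous cK _ _.
    apply: pair_continuous; first exact: fst_continuous.
    by move=> z; apply: continuous_comp; [exact: cvg_snd|exact: ptmap_continuous].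
  by move=> [t x] [].
- by move=> x; rewrite K0.
- by move=> x; rewrite K1.
- by move=> t t01; rewrite ptmap_point Kp.
Qed.

End homotopy.

Section htop.
Variable R : realType.

Definition htop_rel (X Y : ptopologicalType) (f g : ptmap X Y) : bool :=
  `[< phomotopic R f g >].

Lemma htop_rel_refl X Y : reflexive (@htop_rel X Y).
Proof. by move=> f; apply/asboolP; exact: phomotopic_refl. Qed.

Lemma htop_rel_sym X Y : symmetric (@htop_rel X Y).
Proof. by move=> f g; apply/asbool_equiv_eq; split; exact: phomotopic_sym. Qed.

Lemma htop_rel_trans X Y : transitive (@htop_rel X Y).
Proof.
by move=> g f h /asboolP fg /asboolP gh; apply/asboolP; exact: phomotopic_trans gh.
Qed.

Canonical htop_equiv X Y := EquivRel (@htop_rel X Y)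
  (@htop_rel_refl X Y) (@htop_rel_sym X Y) (@htop_rel_trans X Y).

(* The hom-sets of HTop_*. *)
Definition htop (X Y : ptopologicalType) : Type := {eq_quot @htop_equiv X Y}.

HB.instance Definition _ X Y := Quotient.on (htop X Y).
HB.instance Definition _ X Y := Choice.on (htop X Y).

Definition hclass X Y (f : ptmap X Y) : htop X Y := \pi f.

Lemma hclassP X Y (f g : ptmap X Y) : hclass f = hclass g <-> phomotopic R f g.
Proof. by split => [/eqmodP/asboolP|fg]//; apply/eqmodP/asboolP. Qed.

Lemma hreprK X Y (f : htop X Y) : hclass (repr f) = f.
Proof. exact: reprK. Qed.

Definition hid (X : ptopologicalType) : htop X X := hclass (ptid X).

Definition hconst (X Y : ptopologicalType) : htop X Y := hclass (ptconst X Y).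

Definition hcomp X Y Z (g : htop Y Z) (f : htop X Y) : htop X Z :=
  hclass (ptcomp (repr g) (repr f)).

Lemma hcompE X Y Z (g : ptmap Y Z) (f : ptmap X Y) :
  hcomp (hclass g) (hclass f) = hclass (ptcomp g f).
Proof. by apply/hclassP/phomotopic_comp; apply/hclassP; rewrite hreprK. Qed.

Lemma hcompA X Y Z T (h : htop Z T) (g : htop Y Z) (f : htop X Y) :
  hcomp h (hcomp g f) = hcomp (hcomp h g) f.
Proof.
rewrite -[h]hreprK -[g]hreprK -[f]hreprK !hcompE.
by congr hclass; exact: ptmapP.
Qed.

Lemma hcomp1l X Y (f : htop X Y) : hcomp (hid Y) f = f.
Proof. by rewrite -[f]hreprK hcompE; congr hclass; exact: ptmapP. Qed.

Lemma hcomp1r X Y (f : htop X Y) : hcomp f (hid X) = f.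
Proof. by rewrite -[f]hreprK hcompE; congr hclass; exact: ptmapP. Qed.

Lemma hcomp0r X Y Z (g : htop Y Z) : hcomp g (hconst X Y) = hconst X Z.
Proof.
rewrite -[g]hreprK hcompE; congr hclass; apply: ptmapP => x.
exact: ptmap_point.
Qed.

Lemma hcomp0l X Y Z (f : htop X Y) : hcomp (hconst Y Z) f = hconst X Z.
Proof. by rewrite -[f]hreprK hcompE; congr hclass; exact: ptmapP. Qed.

Definition htop_iso (X Y : ptopologicalType) : Prop :=
  exists (f : htop X Y) (g : htop Y X), hcomp g f = hid X /\ hcomp f g = hid Y.

End htop.

Section invsys.
Variable R : realType.

(* Inverse systems in HTop_*; a directed set is a nonempty directed preorder. *)
Record invsys := InvSys {
  idx : Type;
  ile : idx -> idx -> Prop;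
  ile_refl : forall a, ile a a;
  ile_trans : forall a b c, ile a b -> ile b c -> ile a c;
  ile_directed : forall a b, exists c, ile a c /\ ile b c;
  idx_nonempty : inhabited idx;
  term :> idx -> ptopologicalType;
  bond : forall a b, ile a b -> htop R (term b) (term a);
  bond_id : forall a (h : ile a a), bond h = hid R (term a);
  bond_comp : forall a b c (h : ile a b) (h' : ile b c) (h'' : ile a c),
    hcomp (bond h) (bond h') = bond h'' }.

(* The S^*-morphisms $(f, f^n_\mu)$. *)
Record smor (X Y : invsys) := SMor {
  sidx : idx Y -> idx X;
  smap :> forall (n : nat) (m : idx Y), htop R (X (sidx m)) (Y m);
  smorP : forall (m m' : idx Y) (h : ile m m'),
    exists l (h1 : ile (sidx m) l) (h2 : ile (sidx m') l) (n0 : nat),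
    forall n, (n0 <= n)%N ->
      hcomp (bond h) (hcomp (smap n m') (bond h2)) = hcomp (smap n m) (bond h1) }.

HB.instance Definition _ X Y := gen_eqMixin (smor X Y).
HB.instance Definition _ X Y := gen_choiceMixin (smor X Y).

Definition seqv (X Y : invsys) (f g : smor X Y) : Prop :=
  forall m : idx Y, exists l (h1 : ile (sidx f m) l) (h2 : ile (sidx g m) l) (n0 : nat),
  forall n, (n0 <= n)%N -> hcomp (f n m) (bond h1) = hcomp (g n m) (bond h2).

Lemma bond_comp_r (X : invsys) (a b c : idx X) (h : ile a b) (h' : ile b c)
    (h'' : ile a c) Z (f : htop R (X a) Z) :
  hcomp (hcomp f (bond h)) (bond h') = hcomp f (bond h'').
Proof. by rewrite -hcompA (bond_comp h h' h''). Qed.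

Lemma seqv_refl X Y (f : smor X Y) : seqv f f.
Proof. by move=> m; exists (sidx f m), (ile_refl _), (ile_refl _), 0%N. Qed.

Lemma seqv_sym X Y (f g : smor X Y) : seqv f g -> seqv g f.
Proof.
move=> fg m; have [l [h1 [h2 [n0 H]]]] := fg m.
by exists l, h2, h1, n0 => n n0n; rewrite H.
Qed.

Lemma seqv_trans X Y (f g h : smor X Y) : seqv f g -> seqv g h -> seqv f h.
Proof.
move=> fg gh m; have [l [h1 [h2 [n0 H]]]] := fg m.
have [l' [h1' [h2' [n0' H']]]] := gh m.
have [u [lu l'u]] := ile_directed l l'.
exists u, (ile_trans h1 lu), (ile_trans h2' l'u), (maxn n0 n0') => n.
rewrite geq_max => /andP[n0n n0'n].
rewrite -(bond_comp_r h1 lu) H// (bond_comp_r h2 lu (ile_trans h2 lu)).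
rewrite -(bond_comp_r h2' l'u) -H'//.
by rewrite (bond_comp_r h1' l'u (ile_trans h2 lu)).
Qed.

Definition srel X Y (f g : smor X Y) : bool := `[< seqv f g >].

Lemma srel_refl X Y : reflexive (@srel X Y).
Proof. by move=> f; apply/asboolP; exact: seqv_refl. Qed.

Lemma srel_sym X Y : symmetric (@srel X Y).
Proof. by move=> f g; apply/asbool_equiv_eq; split; exact: seqv_sym. Qed.

Lemma srel_trans X Y : transitive (@srel X Y).
Proof.
by move=> g f h /asboolP fg /asboolP gh; apply/asboolP; exact: seqv_trans gh.
Qed.

Canonical sequiv X Y := EquivRel (@srel X Y)
  (@srel_refl X Y) (@srel_sym X Y) (@srel_trans X Y).

(* The hom-sets of pro^*-HTop_*. *)
Definition prostar (X Y : invsys) : Type := {eq_quot @sequiv X Y}.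

HB.instance Definition _ X Y := Quotient.on (prostar X Y).
HB.instance Definition _ X Y := Choice.on (prostar X Y).

Definition sclass X Y (f : smor X Y) : prostar X Y := \pi f.

Lemma sclassP X Y (f g : smor X Y) : sclass f = sclass g <-> seqv f g.
Proof. by split => [/eqmodP/asboolP|fg]//; apply/eqmodP/asboolP. Qed.

Lemma sreprK X Y (f : prostar X Y) : sclass (repr f) = f.
Proof. exact: reprK. Qed.

Lemma smor_id_subproof (X : invsys) (m m' : idx X) (h : ile m m') :
  exists l (h1 : ile m l) (h2 : ile m' l) (n0 : nat),
    forall n : nat, (n0 <= n)%N ->
      hcomp (bond h) (hcomp (hid R (X m')) (bond h2)) =
      hcomp (hid R (X m)) (bond h1).
Proof.
exists m', h, (ile_refl _), 0%N => n _.
by rewrite !hcomp1l bond_id hcomp1r.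
Qed.

Definition smor_id (X : invsys) : smor X X :=
  @SMor X X id (fun _ m => hid R (X m)) (@smor_id_subproof X).

Lemma smor_comp_subproof (X Y Z : invsys) (g : smor Y Z) (f : smor X Y)
    (m m' : idx Z) (h : ile m m') :
  exists l (h1 : ile (sidx f (sidx g m)) l) (h2 : ile (sidx f (sidx g m')) l)
      (n0 : nat),
    forall n, (n0 <= n)%N ->
      hcomp (bond h) (hcomp (hcomp (g n m') (f n (sidx g m'))) (bond h2)) =
      hcomp (hcomp (g n m) (f n (sidx g m))) (bond h1).
Proof.
have [u [k1 [k2 [ng Hg]]]] := smorP g h.
have [l1 [a1 [b1 [n1 H1]]]] := smorP f k1.
have [l2 [a2 [b2 [n2 H2]]]] := smorP f k2.
have [l [l1l l2l]] := ile_directed l1 l2.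
exists l, (ile_trans a1 l1l), (ile_trans a2 l2l), (maxn ng (maxn n1 n2)) => n.
rewrite !geq_max => /and3P[ngn n1n n2n].
rewrite -(bond_comp_r a1 l1l) -(hcompA (g n m)) -H1//.
rewrite -(bond_comp_r a2 l2l) -(hcompA (g n m')) -H2//.
rewrite !hcompA -(hcompA (bond h)) Hg//.
rewrite -!hcompA (bond_comp b2 l2l (ile_trans b2 l2l)).
by rewrite (bond_comp b1 l1l (ile_trans b2 l2l)).
Qed.

Definition smor_comp (X Y Z : invsys) (g : smor Y Z) (f : smor X Y) : smor X Z :=
  @SMor X Z (sidx f \o sidx g) (fun n m => hcomp (g n m) (f n (sidx g m)))
    (@smor_comp_subproof X Y Z g f).

Lemma smor_comp_seqv (X Y Z : invsys) (g g' : smor Y Z) (f f' : smor X Y) :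
  seqv g g' -> seqv f f' -> seqv (smor_comp g f) (smor_comp g' f').
Proof.
move=> gg ff; apply: (@seqv_trans _ _ _ (smor_comp g f')) => m /=.
  have [l [h1 [h2 [n0 H]]]] := ff (sidx g m).
  by exists l, h1, h2, n0 => n n0n; rewrite -!hcompA H.
have [u [k1 [k2 [ng Hg]]]] := gg m.
have [l1 [a1 [b1 [n1 H1]]]] := smorP f' k1.
have [l2 [a2 [b2 [n2 H2]]]] := smorP f' k2.
have [l [l1l l2l]] := ile_directed l1 l2.
exists l, (ile_trans a1 l1l), (ile_trans a2 l2l), (maxn ng (maxn n1 n2)) => n.
rewrite !geq_max => /and3P[ngn n1n n2n].
rewrite -(bond_comp_r a1 l1l) -(hcompA (g n m)) -H1//.
rewrite -(bond_comp_r a2 l2l) -(hcompA (g' n m)) -H2//.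
rewrite !hcompA Hg// -!hcompA (bond_comp b2 l2l (ile_trans b2 l2l)).
by rewrite (bond_comp b1 l1l (ile_trans b2 l2l)).
Qed.

Definition pro_comp (X Y Z : invsys) (G : prostar Y Z) (F : prostar X Y) : prostar X Z :=
  sclass (smor_comp (repr G) (repr F)).

Lemma pro_compE X Y Z (g : smor Y Z) (f : smor X Y) :
  pro_comp (sclass g) (sclass f) = sclass (smor_comp g f).
Proof. by apply/sclassP/smor_comp_seqv; apply/sclassP; rewrite sreprK. Qed.

Lemma pro_compA X Y Z T (H : prostar Z T) (G : prostar Y Z) (F : prostar X Y) :
  pro_comp H (pro_comp G F) = pro_comp (pro_comp H G) F.
Proof.
rewrite -[H]sreprK -[G]sreprK -[F]sreprK !pro_compE; apply/sclassP => m /=.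
by exists _, (ile_refl _), (ile_refl _), 0%N => n _; rewrite hcompA.
Qed.

Lemma pro_comp1l X Y (F : prostar X Y) : pro_comp (sclass (smor_id Y)) F = F.
Proof.
rewrite -[F]sreprK pro_compE; apply/sclassP => m /=.
by exists _, (ile_refl _), (ile_refl _), 0%N => n _; rewrite hcomp1l.
Qed.

Lemma pro_comp1r X Y (F : prostar X Y) : pro_comp F (sclass (smor_id X)) = F.
Proof.
rewrite -[F]sreprK pro_compE; apply/sclassP => m /=.
by exists _, (ile_refl _), (ile_refl _), 0%N => n _; rewrite hcomp1r.
Qed.

Lemma smor_const_subproof (X Y : invsys) (a : idx X) (m m' : idx Y) (h : ile m m') :
  exists l (h1 : ile a l) (h2 : ile a l) (n0 : nat),
    forall n : nat, (n0 <= n)%N ->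
      hcomp (bond h) (hcomp (hconst R (X a) (Y m')) (bond h2)) =
      hcomp (hconst R (X a) (Y m)) (bond h1).
Proof.
exists a, (ile_refl _), (ile_refl _), 0%N => n _.
by rewrite !hcomp0l hcomp0r.
Qed.

Definition smor_const (X Y : invsys) : smor X Y :=
  let a := inhabited_witness (idx_nonempty X) in
  @SMor X Y (fun=> a) (fun _ m => hconst R (X a) (Y m))
    (@smor_const_subproof X Y a).

Definition pzero (X Y : invsys) : prostar X Y := sclass (smor_const X Y).

Lemma pro_comp0r X Y Z (G : prostar Y Z) : pro_comp G (pzero X Y) = pzero X Z.
Proof.
rewrite -[G]sreprK pro_compE; apply/sclassP => m /=.
by exists _, (ile_refl _), (ile_refl _), 0%N => n _; rewrite hcomp0r.
Qed.

Definition movable_system (X : invsys) : Prop :=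
  forall l : idx X, exists (l' : idx X) (h' : ile l l'),
  forall (l'' : idx X) (h'' : ile l l''),
  exists r : htop R (X l') (X l''), hcomp (bond h'') r = bond h'.

End invsys.

Section polyhedra.
Variable R : realType.

(* Abstract simplicial complexes with vertex set V. *)
Record scomplex (V : choiceType) := SComplex {
  simplex :> {fset V} -> Prop;
  simplex0 : ~ simplex fset0;
  simplex1 : forall v, simplex [fset v]%fset;
  simplex_sub : forall s t : {fset V},
    simplex s -> (t `<=` s)%fset -> t != fset0 -> simplex t }.

(* Points of the geometric realization, in barycentric coordinates. *)
Record realization (V : choiceType) (K : scomplex V) := Realization {
  bary :> V -> R;
  baryP : exists s : {fset V}, [/\ K s, forall v, 0 <= bary v,
    forall v, v \notin s -> bary v = 0 & \sum_(v <- s) bary v = 1] }.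

HB.instance Definition _ V (K : scomplex V) := gen_eqMixin (realization K).
HB.instance Definition _ V (K : scomplex V) := gen_choiceMixin (realization K).

Section weak_topology.
Variables (V : choiceType) (K : scomplex V).

(* The closed simplex spanned by s. *)
Definition face (s : {fset V}) : set (realization K) :=
  [set x | forall v, v \notin s -> x v = 0].

(* The weak topology: U is open when its trace on every closed simplex is open
   for the Euclidean topology, i.e. is the trace of an open set of R^V. *)
Definition realization_open (U : set (realization K)) : Prop :=
  forall s, K s -> exists W : set {ptws V -> R},
    open W /\ forall x, face s x -> (U x <-> W x).

Lemma realization_openT : realization_open setT.
Proof. by move=> s _; exists setT; split => //; exact: openT. Qed.

Lemma realization_openI : setI_closed realization_open.
Proof.
move=> A B oA oB s Ks.
have [W [oW AW]] := oA s Ks; have [W' [oW' BW']] := oB s Ks.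
exists (W `&` W'); split; first exact: openI.
by move=> x sx; split => -[] /=; rewrite AW// BW'.
Qed.

Lemma realization_open_bigU (I : Type) (f : I -> set (realization K)) :
  (forall i, realization_open (f i)) -> realization_open (\bigcup_i f i).
Proof.
move=> of_ s Ks; pose W i := projT1 (cid (of_ i s Ks)).
have WP i : open (W i) /\ forall x, face s x -> (f i x <-> W i x).
  exact: projT2 (cid (of_ i s Ks)).
exists (\bigcup_i W i); split; first by apply: bigcup_open => i _; case: (WP i).
move=> x sx; split => -[i _ Hi]; exists i => //.
  by apply/(WP i).2.
by apply/((WP i).2 _ sx).
Qed.

HB.instance Definition _ := isOpenTopological.Build (realization K)
  realization_openT realization_openI realization_open_bigU.

Definition pointed_realization (b : realization K) : Type := realization K.

HB.instance Definition _ b := Topological.on (pointed_realization b).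
HB.instance Definition _ b := isPointed.Build (pointed_realization b) b.

End weak_topology.

Definition homeomorphic (S T : topologicalType) : Prop :=
  exists (f : S -> T) (g : T -> S),
    [/\ continuous f, continuous g, cancel f g & cancel g f].

Definition polyhedron (T : topologicalType) : Prop :=
  exists (V : choiceType) (K : scomplex V), homeomorphic T (realization K).

Definition compact_polyhedron (T : topologicalType) : Prop :=
  polyhedron T /\ compact [set: T].

(* X has the homotopy type of a pointed polyhedron; the base point of a pointed
   polyhedron need not be a vertex. *)
Definition HPol (X : ptopologicalType) : Prop :=
  exists (V : choiceType) (K : scomplex V) (b : realization K),
    htop_iso R X (pointed_realization b).

End polyhedra.

Section expansions.
Variable R : realType.

(* Inverse systems under X, i.e. morphisms (p_l) : X -> (X_l, p_{ll'}) of
   pro-HTop_*. *)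
Record under (X : ptopologicalType) := Under {
  usys :> invsys R;
  proj : forall l, htop R X (usys l);
  proj_bond : forall a b (h : ile a b), hcomp (bond h) (proj b) = proj a }.

Arguments proj {X} u l.

(* The rudimentary system of X, indexed by a point. *)
Definition rud_sys (X : ptopologicalType) : invsys R :=
  @InvSys R unit (fun _ _ => True) (fun=> I) (fun _ _ _ _ _ => I)
    (fun _ _ => ex_intro _ tt (conj I I)) (inhabits tt)
    (fun=> X) (fun _ _ _ => hid R X) (fun _ _ => erefl)
    (fun _ _ _ _ _ _ => hcomp1l (hid R X)).

Definition rud (X : ptopologicalType) : under X :=
  @Under X (rud_sys X) (fun=> hid R X) (fun _ _ _ => hcomp1l (hid R X)).

Definition HPol_expansion X (p : under X) : Prop :=
  [/\ forall l, HPol R (p l),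
      forall P, HPol R P -> forall h : htop R X P,
        exists l (f : htop R (p l) P), h = hcomp f (proj p l) &
      forall P, HPol R P -> forall l (f0 f1 : htop R (p l) P),
        hcomp f0 (proj p l) = hcomp f1 (proj p l) ->
        exists l' (h : ile l l'), hcomp f0 (bond h) = hcomp f1 (bond h)].

Definition movable (X : ptopologicalType) : Prop :=
  exists p : under X, HPol_expansion p /\ movable_system p.

Lemma rud_expansion X : HPol R X -> HPol_expansion (rud X).
Proof.
move=> HX; split => // [P HP h|P HP [] f0 f1]; first by exists tt, h; rewrite hcomp1r.
by move=> e; exists tt, I.
Qed.

Definition has_expansion X : Prop := exists p : under X, HPol_expansion p.

Lemma HPol_has_expansion X : HPol R X -> has_expansion X.
Proof. by exists (rud X); exact: rud_expansion. Qed.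

(* F is the morphism of pro-HTop_* (as a morphism of pro^*-HTop_* with a
   representative independent of n) such that F o p = q o h. *)
Definition induces X Y (p : under X) (q : under Y) (h : htop R X Y)
    (F : prostar p q) : Prop :=
  exists f : smor p q, [/\ F = sclass f, forall n m, f n m = f 0%N m &
    forall m, hcomp (f 0%N m) (proj p (sidx f m)) = hcomp (proj q m) h].

Lemma induces_exists X Y (p : under X) (q : under Y) (h : htop R X Y) :
  HPol_expansion p -> (forall m, HPol R (q m)) -> exists F, induces h (F : prostar p q).
Proof.
move=> [_ E1 E2] Hq.
have /choice[s sP] : forall m, exists l, exists f : htop R (p l) (q m),
    hcomp (proj q m) h = hcomp f (proj p l) by move=> m; exact: E1.
pose f m := projT1 (cid (sP m)).
have fP m : hcomp (proj q m) h = hcomp (f m) (proj p (s m)).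
  exact: projT2 (cid (sP m)).
have H (m m' : idx q) (k : ile m m') :
    exists l (h1 : ile (s m) l) (h2 : ile (s m') l) (n0 : nat), forall n, (n0 <= n)%N ->
    hcomp (bond k) (hcomp (f m') (bond h2)) = hcomp (f m) (bond h1).
  have [u [mu m'u]] := ile_directed (s m) (s m').
  have [|l [ul]] := E2 _ (Hq m) u (hcomp (bond k) (hcomp (f m') (bond m'u)))
      (hcomp (f m) (bond mu)).
    by rewrite -!hcompA !proj_bond -!fP hcompA proj_bond.
  rewrite (bond_comp_r mu ul (ile_trans mu ul)) -!hcompA.
  rewrite (bond_comp m'u ul (ile_trans m'u ul)) => e.
  by exists l, (ile_trans mu ul), (ile_trans m'u ul), 0%N.
pose g : smor p q := @SMor R p q s (fun _ m => f m) H.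
by exists (sclass g), g; split => //= m; rewrite fP.
Qed.

Lemma induces_unique X Y (p : under X) (q : under Y) (h : htop R X Y) F G :
  HPol_expansion p -> (forall m, HPol R (q m)) ->
  @induces X Y p q h F -> induces h G -> F = G.
Proof.
move=> [_ _ E2] Hq [f [-> fn fp]] [g [-> gn gp]]; apply/sclassP => m.
have [u [mu m'u]] := ile_directed (sidx f m) (sidx g m).
have [|l [ul e]] := E2 _ (Hq m) u (hcomp (f 0%N m) (bond mu)) (hcomp (g 0%N m) (bond m'u)).
  by rewrite -!hcompA !proj_bond fp gp.
exists l, (ile_trans mu ul), (ile_trans m'u ul), 0%N => n _; rewrite fn gn.
by rewrite -(bond_comp_r mu ul) -(bond_comp_r m'u ul).
Qed.

Lemma induces_comp X Y Z (p : under X) (q : under Y) (r : under Z)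
    (h : htop R X Y) (k : htop R Y Z) (F : prostar p q) (G : prostar q r) :
  induces h F -> induces k G -> induces (hcomp k h) (pro_comp G F).
Proof.
move=> [f [-> fn fp]] [g [-> gn gp]]; exists (smor_comp g f).
split => [|n m /=|m /=]; first by rewrite pro_compE.
  by rewrite gn fn.
by rewrite -hcompA fp hcompA gp hcompA.
Qed.

Lemma induces_id X (p : under X) : induces (hid R X) (sclass (smor_id p)).
Proof.
by exists (smor_id p); split => // m /=; rewrite hcomp1l hcomp1r.
Qed.

(* For an HPol_*-expansion p and q with terms in HPol_* there is exactly one
   such F, see [induces_exists] and [induces_unique]; the default value pzero
   only serves to make the definition total. *)
Definition induced X Y (p : under X) (q : under Y) (h : htop R X Y) : prostar p q :=
  xget (pzero p q) (@induces X Y p q h).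

(* A choice of an HPol_*-expansion for every pointed space; hom-sets computed
   with other expansions are compared with the chosen ones by [sh_class].
   Every pointed space has an expansion; as this existence theorem is not proved
   here, rud X is used as a default value. *)
Definition expansion_of (X : ptopologicalType) : under X :=
  if pselect (has_expansion X) is left e then projT1 (cid e) else rud X.

Lemma expansion_ofP X : has_expansion X -> HPol_expansion (expansion_of X).
Proof.
by rewrite /expansion_of => ?; case: pselect => // e; exact: projT2 (cid e).
Qed.

End expansions.

Arguments proj {R X} u l.

Section coarse_shape.
Variable R : realType.

(* The hom-sets of the pointed coarse shape category Sh^*_*. *)
Definition Sh (X Y : ptopologicalType) : Type :=
  prostar (expansion_of R X) (expansion_of R Y).

HB.instance Definition _ X Y := Choice.on (Sh X Y).
HB.instance Definition _ X Y := isPointed.Build (Sh X Y) (pzero _ _).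

Definition sh_comp X Y Z (G : Sh Y Z) (F : Sh X Y) : Sh X Z := pro_comp G F.

(* The coarse shape morphism represented by F : p -> q, for HPol_*-expansions
   p of X and q of Y; induced by identities, the outer factors are the canonical
   isomorphisms with the chosen expansions. *)
Definition sh_class X Y (p : under R X) (q : under R Y) (F : prostar p q) : Sh X Y :=
  pro_comp (induced q (expansion_of R Y) (hid R Y))
    (pro_comp F (induced (expansion_of R X) p (hid R X))).

(* The coarse shape morphism induced by a morphism of HTop_*. *)
Definition sh_htop X Y (h : htop R X Y) : Sh X Y :=
  induced (expansion_of R X) (expansion_of R Y) h.

Definition sh_push A X Y (h : htop R X Y) (F : Sh A X) : Sh A Y :=
  sh_comp (sh_htop h) F.

Lemma sh_htopP X Y (h : htop R X Y) : has_expansion R X -> has_expansion R Y ->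
  induces h (sh_htop h).
Proof.
move=> /expansion_ofP HX /expansion_ofP[HY _ _].
rewrite /sh_htop /induced; case: xgetP => [F -> //|H].
by have [F /H] := induces_exists h HX HY.
Qed.

Lemma sh_htop_comp X Y Z (h : htop R X Y) (k : htop R Y Z) :
  has_expansion R X -> has_expansion R Y -> has_expansion R Z ->
  sh_htop (hcomp k h) = sh_comp (sh_htop k) (sh_htop h).
Proof.
move=> HX HY HZ; have [HZ' _ _] := expansion_ofP HZ.
apply: (induces_unique (expansion_ofP HX) HZ'); first exact: sh_htopP.
by apply: induces_comp; exact: sh_htopP.
Qed.

Lemma sh_push_comp A X Y Z (h : htop R X Y) (k : htop R Y Z) (F : Sh A X) :
  has_expansion R X -> has_expansion R Y -> has_expansion R Z ->
  sh_push (hcomp k h) F = sh_push k (sh_push h F).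
Proof. by move=> HX HY HZ; rewrite /sh_push sh_htop_comp// /sh_comp pro_compA. Qed.

Lemma sh_push_id A X (F : Sh A X) : has_expansion R X -> sh_push (hid R X) F = F.
Proof.
move=> HX; rewrite /sh_push (_ : sh_htop _ = sclass (smor_id _)) ?[sh_comp _ _]pro_comp1l//.
have [HX' _ _] := expansion_ofP HX.
apply: (induces_unique (expansion_ofP HX) HX'); first exact: sh_htopP.
exact: induces_id.
Qed.

Lemma sh_push_point A X Y (h : htop R X Y) : sh_push h (point : Sh A X) = point.
Proof. exact: pro_comp0r. Qed.

Section topology.
Variables A X : ptopologicalType.

(* The basic set V^F_l, for an index l of an HPol_*-expansion p of X. *)
Definition sh_basic (p : under R X) (F : Sh A X) (l : idx p) : set (Sh A X) :=
  [set G | sh_push (proj p l) F = sh_push (proj p l) G].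

(* The topology with basis the sets V^F_l. *)
Definition sh_open (U : set (Sh A X)) : Prop :=
  forall G, U G -> exists (F : Sh A X) (l : idx (expansion_of R X)),
    sh_basic F l G /\ sh_basic F l `<=` U.

Lemma sh_openT : sh_open setT.
Proof.
move=> G _; have l := inhabited_witness (idx_nonempty (expansion_of R X)).
by exists G, l.
Qed.

Lemma expansion_of_le (a b : idx (expansion_of R X)) :
  exists c : idx (expansion_of R X),
  forall F G : Sh A X, sh_basic F c G -> sh_basic F a G /\ sh_basic F b G.
Proof.
have [HX|nX] := pselect (has_expansion R X).
  have [HP _ _] := expansion_ofP HX.
  have [c [ac bc]] := ile_directed a b.
  exists c => F G; rewrite /sh_basic /= => FG; split;
    [rewrite -(proj_bond ac)|rewrite -(proj_bond bc)];
    rewrite !sh_push_comp ?FG//; exact: HPol_has_expansion.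
exists a => F G FG; split => //; suff -> : b = a by [].
move: a b {FG}; rewrite /expansion_of; case: pselect => //= _.
by move=> [] [].
Qed.

Lemma sh_openI : setI_closed sh_open.
Proof.
move=> U V oU oV G [UG VG].
have [F [a [FG FU]]] := oU _ UG; have [F' [b [FG' FV]]] := oV _ VG.
have [c cP] := expansion_of_le a b.
exists G, c; split => //= H GH; have [Ha Hb] := cP _ _ GH; split.
- by apply: FU; rewrite /sh_basic/= FG.
- by apply: FV; rewrite /sh_basic/= FG'.
Qed.

Lemma sh_open_bigU (I : Type) (f : I -> set (Sh A X)) :
  (forall i, sh_open (f i)) -> sh_open (\bigcup_i f i).
Proof.
move=> of_ G [i _ fG]; have [F [l [FG Ff]]] := of_ i _ fG.
by exists F, l; split => // H /Ff fH; exists i.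
Qed.

HB.instance Definition _ := isOpenTopological.Build (Sh A X)
  sh_openT sh_openI sh_open_bigU.

End topology.

Lemma sh_push_continuous A X Y (h : htop R X Y) :
  has_expansion R X -> has_expansion R Y -> continuous (@sh_push A X Y h).
Proof.
move=> HX HY; apply/continuousP => U oU.
rewrite /open/= => G UG; move: oU; rewrite /open/= => oU.
have [F [m [FG FU]]] := oU _ UG.
have [HX' E1 _] := expansion_ofP HX; have [HY' _ _] := expansion_ofP HY.
have [l [f fE]] := E1 _ (HY' m) (hcomp (proj (expansion_of R Y) m) h).
exists G, l; split => // H GH; apply: FU; rewrite /sh_basic/= FG.
have HXl := HPol_has_expansion (HX' l); have HYm := HPol_has_expansion (HY' m).
by rewrite -!sh_push_comp// fE !sh_push_comp// GH.
Qed.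

Definition sh_ptmap A X Y (HX : has_expansion R X) (HY : has_expansion R Y)
    (h : htop R X Y) : ptmap (Sh A X) (Sh A Y) :=
  PtMap (sh_push_continuous (A := A) (h := h) HX HY) (sh_push_point A h).

(* The inverse system of the spaces Sh(A, X_l) and the maps (p_{ll'})_*. *)
Section sh_sys.
Variables (A : ptopologicalType) (X : invsys R) (HX : forall l, HPol R (X l)).

Let HXl l := HPol_has_expansion (HX l).

Definition sh_bond (a b : idx X) (h : ile a b) : htop R (Sh A (X b)) (Sh A (X a)) :=
  hclass R (sh_ptmap A (HXl b) (HXl a) (bond h)).

Lemma sh_bond_id (a : idx X) (h : ile a a) : sh_bond h = hid R (Sh A (X a)).
Proof.
by congr hclass; apply: ptmapP => F /=; rewrite bond_id sh_push_id.
Qed.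

Lemma sh_bond_comp (a b c : idx X) (h : ile a b) (h' : ile b c) (h'' : ile a c) :
  hcomp (sh_bond h) (sh_bond h') = sh_bond h''.
Proof.
rewrite hcompE; congr hclass; apply: ptmapP => F /=.
by rewrite -sh_push_comp// bond_comp.
Qed.

Definition sh_sys : invsys R :=
  InvSys (@ile_refl R X) (@ile_trans R X) (@ile_directed R X) (idx_nonempty X)
    sh_bond_id sh_bond_comp.

End sh_sys.

(* The morphism p_* : Sh(A, X) -> (Sh(A, X_l)) with components F |-> p_l o F. *)
Section sh_under.
Variables (A X : ptopologicalType) (p : under R X) (Hp : HPol_expansion p).

Let HX : has_expansion R X := ex_intro _ p Hp.
Let Hterm : forall l, HPol R (p l) := let: And3 H _ _ := Hp in H.

Definition sh_proj (l : idx p) : htop R (Sh A X) (Sh A (p l)) :=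
  hclass R (sh_ptmap A HX (HPol_has_expansion (Hterm l)) (proj p l)).

Lemma sh_proj_bond (a b : idx p) (h : ile a b) :
  hcomp (sh_bond A Hterm h) (sh_proj b) = sh_proj a.
Proof.
rewrite hcompE; congr hclass; apply: ptmapP => F /=.
by rewrite -sh_push_comp ?proj_bond//; exact: HPol_has_expansion.
Qed.

Definition sh_under : under R (Sh A X) :=
  @Under R (Sh A X) (sh_sys A Hterm) sh_proj sh_proj_bond.

End sh_under.

End coarse_shape.

Section sphere.
Variable R : realType.

Definition cube (k : nat) : Type :=
  [set v : 'rV[R]_k | forall i, 0 <= v ord0 i <= 1].

HB.instance Definition _ k := Topological.on (cube k).

Definition coord k (s : cube k) (i : 'I_k) : R := (set_val s : 'rV[R]_k) ord0 i.

Lemma coord01 k (s : cube k) i : 0 <= coord s i <= 1.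
Proof. exact: (set_valP s). Qed.

Lemma cube_subproof k (u : 'I_k -> R) : (forall i, 0 <= u i <= 1) ->
  (\row_i u i) \in [set v : 'rV[R]_k | forall i, 0 <= v ord0 i <= 1].
Proof. by move=> u01; rewrite inE /= => i; rewrite mxE. Qed.

Definition mk_cube k (u : 'I_k -> R) (u01 : forall i, 0 <= u i <= 1) : cube k :=
  exist _ (\row_i u i) (cube_subproof u01).

Lemma coord_mk k (u : 'I_k -> R) (u01 : forall i, 0 <= u i <= 1) i :
  coord (mk_cube u01) i = u i.
Proof. by rewrite /coord /= mxE. Qed.

Lemma coord_continuous_cube k (i : 'I_k) : continuous ((@coord k)^~ i).
Proof.
move=> s; apply: (@continuous_comp _ _ _ set_val (fun v : 'rV[R]_k => v ord0 i)).
  exact: initial_continuous.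
exact: coord_continuous.
Qed.

Lemma cube_continuous (T : topologicalType) k (f : T -> cube k) :
  (forall i, continuous (fun t => coord (f t) i)) -> continuous f.
Proof.
move=> cf; apply: continuous_comp_initial => t U -[P Pt PU].
apply: (filterS PU); rewrite /=.
suff : \forall t' \near t, forall i, P ord0 i (coord (f t') i).
  by apply: filterS => t' Pt' i j; rewrite ord1; exact: Pt'.
apply: filter_forall => i; exact: (cf i t _ (Pt ord0 i)).
Qed.

Lemma cube_origin_subproof k (i : 'I_k) :
  (0 : R) <= 0 <= (1 : R).
Proof. by rewrite lexx; exact: ler01. Qed.

HB.instance Definition _ k := isPointed.Build (cube k) (mk_cube (@cube_origin_subproof k)).

Definition cube_boundary k (s : cube k) : bool :=
  [exists i, (coord s i == 0) || (coord s i == 1)].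

Definition sphere_rel k (s t : cube k) : bool :=
  (s == t) || (cube_boundary s && cube_boundary t).

Lemma sphere_rel_refl k : reflexive (@sphere_rel k).
Proof. by move=> s; rewrite /sphere_rel eqxx. Qed.

Lemma sphere_rel_sym k : symmetric (@sphere_rel k).
Proof. by move=> s t; rewrite /sphere_rel eq_sym andbC. Qed.

Lemma sphere_rel_trans k : transitive (@sphere_rel k).
Proof.
move=> s t u /orP[/eqP->//|/andP[bt bs]] /orP[/eqP<-|/andP[_ bu]];
  by rewrite /sphere_rel bt ?bs ?bu ?orbT.
Qed.

Canonical sphere_equiv k := EquivRel (@sphere_rel k)
  (@sphere_rel_refl k) (@sphere_rel_sym k) (@sphere_rel_trans k).

(* The pointed sphere S^k as I^k / bd(I^k), based at the class of bd(I^k); this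
   is the k-sphere for k > 0 only. *)
Definition sphere (k : nat) : Type := quotient_topology {eq_quot @sphere_equiv k}.

HB.instance Definition _ k := Quotient.on (sphere k).
HB.instance Definition _ k := PointedTopological.on (sphere k).

Section sum.
Variable k : nat.
Local Notation S := (sphere k.+1).

Lemma sphereP (s t : cube k.+1) : (\pi_S s == \pi_S t) = sphere_rel s t.
Proof. by apply/idP/idP => [/eqP/eqmodP//|st]; exact/eqP/eqmodP. Qed.

Lemma point_boundary : cube_boundary (point : cube k.+1).
Proof. by apply/existsP; exists ord0; rewrite coord_mk eqxx. Qed.

Lemma pi_boundary (s : cube k.+1) : cube_boundary s <-> \pi_S s = point.
Proof.
split=> [bs|].
  by apply/eqP; rewrite sphereP /sphere_rel bs point_boundary orbT.
by move=> /eqP; rewrite sphereP => /orP[/eqP->|/andP[]//]; exact: point_boundary.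
Qed.

Lemma reparam_subproof (a b : R) (s : cube k.+1) (i : 'I_k.+1) :
  0 <= (if i == ord0 then Num.max 0 (Num.min 1 (a * coord s i + b)) else coord s i) <= 1.
Proof.
case: ifP => _; last exact: coord01.
by rewrite le_max lexx/= ge_max ler01 ge_min lexx.
Qed.

(* s |-> (a s_0 + b, s_1, ...), truncated to remain in the cube. *)
Definition reparam (a b : R) (s : cube k.+1) : cube k.+1 :=
  mk_cube (reparam_subproof a b s).

Lemma reparam_cube_continuous a b : continuous (reparam a b).
Proof.
apply: cube_continuous => i; under eq_fun do rewrite coord_mk.
case: eqP => _ s; last exact: coord_continuous_cube.
have cst (c : R) : {for s, continuous (fun _ : cube k.+1 => c : R^o)}.
  exact: cst_continuous.
have aff : {for s, continuous (fun t : cube k.+1 => a * coord t i + b : R^o)}.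
  exact: affine_continuous (@coord_continuous_cube k.+1 i) s.
exact: (continuous_max (cst 0) (continuous_min (cst 1) aff)).
Qed.

(* The sum of f and g in pi_{k+1}: [s] |-> f [2 s_0, s_1, ...] for s_0 <= 1/2
   and [s] |-> g [2 s_0 - 1, s_1, ...] for s_0 >= 1/2. *)
Definition sphere_sum_fun (Y : Type) (f g : S -> Y) (z : S) : Y :=
  let s := repr z in
  if coord s ord0 <= 2^-1 then f (\pi_S (reparam 2 0 s))
  else g (\pi_S (reparam 2 (-1) s)).

Definition half (b : R) (z : S) : S := \pi_S (reparam 2 b (repr z)).

Lemma reparam_boundary b s : b = 0 \/ b = -1 -> cube_boundary s ->
  cube_boundary (reparam 2 b s).
Proof.
move=> hb /existsP[i bi]; apply/existsP; exists i; rewrite coord_mk.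
case: ifP => // _.
by case/orP : bi => /eqP ->; case: hb => ->;
  rewrite ?(mulr0, add0r, addr0, mulr1) ?minEle ?maxEle;
  repeat (case: ifP); rewrite ?eqxx ?orbT//; lra.
Qed.

Lemma halfE b (s : cube k.+1) : b = 0 \/ b = -1 ->
  half b (\pi_S s) = \pi_S (reparam 2 b s).
Proof.
move=> hb; rewrite /half; case: piP => t /eqP; rewrite sphereP.
case/orP => [/eqP -> //|/andP[bs bt]].
have /pi_boundary -> := reparam_boundary hb bt.
by have /pi_boundary -> := reparam_boundary hb bs.
Qed.

Lemma half_continuous b : b = 0 \/ b = -1 -> continuous (half b).
Proof.
move=> hb; apply: (@repr_comp_continuous _ _ _ (\pi_S \o reparam 2 b)).
  move=> s; apply: continuous_comp; first exact: reparam_cube_continuous.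
  exact: pi_continuous.
by move=> s t /eqP st; rewrite /= -!(halfE _ hb) st.
Qed.

Lemma half_point b : b = 0 \/ b = -1 -> half b point = point.
Proof.
by move=> hb; rewrite halfE//; apply/pi_boundary/reparam_boundary => //; exact: point_boundary.
Qed.

Definition side (A : set R) : set S :=
  [set z : S | z = point \/ A (coord (repr z) ord0)].

Lemma side_closed A : closed A -> closed (side A).
Proof.
move=> cA; rewrite -openC /open /= /quotient_open.
rewrite (_ : _ @^-1` _ = ~` ([set s | cube_boundary s] `|`
    (fun s : cube k.+1 => coord s ord0) @^-1` A)); last first.
  apply/seteqP; split => s /=; apply: contra_not => -[].
  - by move=> /pi_boundary ->; left.
  - move=> As; case/boolP : (cube_boundary s) => [/pi_boundary->|bs]; first by left.
    right; rewrite /=; case: piP => t /eqP; rewrite sphereP.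
    case/orP; first by move=> /eqP <-.
    by move=> /andP[]; rewrite (negbTE bs).
  - by move=> /pi_boundary; left.
  - case: piP => t /eqP; rewrite sphereP => /orP[/eqP->|/andP[bs _]]; first by right.
    by left.
rewrite openC; apply: closedU; last first.
  by move/continuous_closedP : (@coord_continuous_cube k.+1 ord0); apply.
rewrite (_ : [set s | _] = \bigcup_(i in [set: 'I_k.+1])
   ((fun s : cube k.+1 => coord s i) @^-1` ([set x | x <= 0] `|` [set x | 1 <= x]))); last first.
  apply/seteqP; split => [s /existsP[i si]|s [i _ /= si]].
    by exists i => //=; case/orP : si => /eqP ->; [left|right].
  apply/existsP; exists i; have /andP[c0 c1] := coord01 s i.
  by apply/orP; case: si => /= si; [left|right];
    apply/eqP/le_anti; rewrite si ?c0 ?c1.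
apply: closed_bigcup => [|i _]; first exact: finite_finset.
move/continuous_closedP : (@coord_continuous_cube k.+1 i); apply.
by apply: closedU; [exact: closed_le|exact: closed_ge].
Qed.

Lemma sphere_sum_glue (T : topologicalType) (Y : ptopologicalType) (C : set T)
    (u : T -> S) (F G : T -> S -> Y) :
  closed C -> continuous u ->
  {within C, continuous (fun t => F t (half 0 (u t)))} ->
  {within C, continuous (fun t => G t (half (-1) (u t)))} ->
  (forall t, C t -> F t point = point) -> (forall t, C t -> G t point = point) ->
  {within C, continuous (fun t => sphere_sum_fun (F t) (G t) (u t))}.
Proof.
move=> cC cu cF cG Fp Gp.
have h0 : (0 : R) = 0 \/ (0 : R) = -1 by left.
have h1 : (-1 : R) = 0 \/ (-1 : R) = -1 by right.
have sum_point t : C t -> sphere_sum_fun (F t) (G t) point = point.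
  move=> Ct; rewrite /sphere_sum_fun -[\pi_S _]/(half 0 point) -[\pi_S _]/(half (-1) point).
  by rewrite !half_point// Fp// Gp// if_same.
have -> : C = (C `&` u @^-1` side [set x | x <= 2^-1]) `|`
             (C `&` u @^-1` side [set x | 2^-1 <= x]).
  rewrite -setIUr; apply/esym/setIidPl => t Ct /=.
  by case: (leP (coord (repr (u t)) ord0) 2^-1) => [|/ltW] ?; [left|right]; right.
have cS A : closed A -> closed (C `&` u @^-1` side A).
  move=> cA; apply: closedI => //.
  by move/continuous_closedP : cu; apply; exact: side_closed.
apply: withinU_continuous; [by apply: cS; exact: closed_le|
  by apply: cS; exact: closed_ge| |].
- apply: (@within_ext _ _ _ (fun t => F t (half 0 (u t)))); last first.
    by apply: continuous_subspaceW cF => t [].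
  move=> t [Ct [->|]]; first by rewrite half_point// sum_point// Fp.
  by rewrite /= /sphere_sum_fun => ->.
- apply: (@within_ext _ _ _ (fun t => G t (half (-1) (u t)))); last first.
    by apply: continuous_subspaceW cG => t [].
  move=> t [Ct [->|]]; first by rewrite half_point// sum_point// Gp.
  rewrite /= /sphere_sum_fun => ge2; case: ifP => // le2.
  have e : coord (repr (u t)) ord0 = 2^-1 by apply/le_anti; rewrite le2 ge2.
  have /pi_boundary -> : cube_boundary (reparam 2 0 (repr (u t))).
    apply/existsP; exists ord0; rewrite coord_mk eqxx e; apply/orP; right.
    by rewrite divff ?pnatr_eq0// addr0 minxx; apply/eqP/max_idPr.
  rewrite /half; have /pi_boundary -> : cube_boundary (reparam 2 (-1) (repr (u t))).
    apply/existsP; exists ord0; rewrite coord_mk eqxx e; apply/orP; left.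
    rewrite divff ?pnatr_eq0// subrr; apply/eqP/max_idPl.
    by rewrite ge_min lexx orbT.
  by rewrite Fp// Gp.
Qed.

Section sum_map.
Variable X : ptopologicalType.

Lemma sphere_sum_continuous (f g : ptmap S X) : continuous (sphere_sum_fun f g).
Proof.
apply/continuous_subspace_setT.
apply: (@sphere_sum_glue S X setT id (fun=> f) (fun=> g)).
- exact: closedT.
- by move=> z; exact: cvg_id.
- apply: continuous_subspaceT => z; apply: continuous_comp; last exact: ptmap_continuous.
  by apply: half_continuous; left.
- apply: continuous_subspaceT => z; apply: continuous_comp; last exact: ptmap_continuous.
  by apply: half_continuous; right.
- by move=> _ _; exact: ptmap_point.
- by move=> _ _; exact: ptmap_point.
Qed.

Lemma sphere_sum_point (f g : ptmap S X) : sphere_sum_fun f g point = point.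
Proof.
rewrite /sphere_sum_fun -[\pi_S _]/(half 0 point) -[\pi_S _]/(half (-1) point).
by rewrite !half_point ?ptmap_point ?if_same//; [right|left].
Qed.

Definition sphere_sum (f g : ptmap S X) : ptmap S X :=
  PtMap (@sphere_sum_continuous f g) (sphere_sum_point f g).

Lemma sphere_sum_homotopic (f f' g g' : ptmap S X) :
  phomotopic R f f' -> phomotopic R g g' ->
  phomotopic R (sphere_sum f g) (sphere_sum f' g').
Proof.
move=> [H [cH H0 H1 Hp]] [K [cK K0 K1 Kp]].
exists (fun z => sphere_sum_fun (fun y => H (z.1, y)) (fun y => K (z.1, y)) z.2); split.
- apply: (@sphere_sum_glue _ X _ snd (fun z y => H (z.1, y)) (fun z y => K (z.1, y))).
  + rewrite (_ : _ `*` _ = fst @^-1` [set` `[0, 1]]); last first.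
      by apply/seteqP; split => [z []|z].
    by move/continuous_closedP : (@fst_continuous R S); apply; exact: itv_closed.
  + exact: snd_continuous.
  + apply: (@within_comp_continuous _ _ _ _ _ (fun z => (z.1, half 0 z.2)) _ cH).
      apply: pair_continuous; first exact: fst_continuous.
      by move=> z; apply: continuous_comp; [exact: cvg_snd|apply: half_continuous; left].
    by move=> z [].
  + apply: (@within_comp_continuous _ _ _ _ _ (fun z => (z.1, half (-1) z.2)) _ cK).
      apply: pair_continuous; first exact: fst_continuous.
      by move=> z; apply: continuous_comp; [exact: cvg_snd|apply: half_continuous; right].
    by move=> z [].
  + by move=> z [z1 _]; exact: Hp.
  + by move=> z [z1 _]; exact: Kp.
- by move=> z; rewrite /= /sphere_sum_fun H0 K0.
- by move=> z; rewrite /= /sphere_sum_fun H1 K1.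
- move=> t t01 /=; rewrite /sphere_sum_fun -[\pi_S _]/(half 0 point).
  rewrite -[\pi_S _]/(half (-1) point).
  by rewrite !half_point ?Hp ?Kp ?if_same//; [right|left].
Qed.

(* The operation of pi_{k+1}(X), as homotopy classes of maps of spheres. *)
Definition hadd (f g : htop R S X) : htop R S X :=
  hclass R (sphere_sum (repr f) (repr g)).

Lemma haddE (f g : ptmap S X) :
  hadd (hclass R f) (hclass R g) = hclass R (sphere_sum f g).
Proof.
by apply/hclassP/sphere_sum_homotopic; apply/hclassP; rewrite hreprK.
Qed.

End sum_map.

Lemma hcomp_hadd (X Y : ptopologicalType) (h : htop R X Y) (f g : htop R S X) :
  hcomp h (hadd f g) = hadd (hcomp h f) (hcomp h g).
Proof.
rewrite -[h]hreprK -[f]hreprK -[g]hreprK haddE !hcompE haddE.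
congr hclass; apply: ptmapP => z /=; rewrite /sphere_sum_fun /=.
by case: ifP.
Qed.

End sum.
End sphere.

Section coarse_group.
Variables (R : realType) (k : nat).
Local Notation S := (sphere R k.+1).

Lemma smor_add_subproof (X : invsys R) (f g : smor (rud_sys R S) X)
    (m m' : idx X) (h : ile m m') :
  exists (l : idx (rud_sys R S)) (h1 h2 : @ile R (rud_sys R S) tt l) (n0 : nat),
    forall n : nat, (n0 <= n)%N ->
      hcomp (bond h) (hcomp (hadd (f n m') (g n m')) (bond h2)) =
      hcomp (hadd (f n m) (g n m)) (bond h1).
Proof.
have [l [h1 [h2 [n1 fP]]]] := smorP f h.
have [l' [h1' [h2' [n2 gP]]]] := smorP g h.
exists tt, I, I, (maxn n1 n2) => n; rewrite geq_max => /andP[n1n n2n].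
rewrite !hcomp1r hcomp_hadd; congr hadd.
  by have := fP n n1n; rewrite !hcomp1r.
by have := gP n n2n; rewrite !hcomp1r.
Qed.

(* (f^n_m) + (g^n_m) = (f^n_m + g^n_m). *)
Definition smor_add (X : invsys R) (f g : smor (rud_sys R S) X) :
    smor (rud_sys R S) X :=
  @SMor R (rud_sys R S) X (fun=> tt) (fun n m => hadd (f n m) (g n m))
    (@smor_add_subproof X f g).

(* A representative S -> expansion_of X of F; the sphere, a polyhedron, is its
   own expansion. *)
Definition sh_repr (X : ptopologicalType) (F : Sh R S X) :
    smor (rud_sys R S) (expansion_of R X) :=
  xget (smor_const _ _)
    [set f | sh_class (p := rud R S) (q := expansion_of R X) (sclass f) = F].

Definition coarse_add (X : ptopologicalType) (F G : Sh R S X) : Sh R S X :=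
  sh_class (p := rud R S) (q := expansion_of R X)
    (sclass (smor_add (sh_repr F) (sh_repr G))).

End coarse_group.

(* A topological group, written with its unit as the base point. *)
Definition topological_group (T : ptopologicalType) (op : T -> T -> T) : Prop :=
  exists inv : T -> T,
    [/\ associative op,
        left_id point op /\ right_id point op,
        left_inverse point inv op /\ right_inverse point inv op,
        continuous (fun z : T * T => op z.1 z.2) &
        continuous inv].

Definition movable_topological_group (R : realType) (T : ptopologicalType)
    (op : T -> T -> T) : Prop :=
  topological_group op /\ movable R T.

(* Main.v *)
(* The sphere S = S^(k+1) is a polyhedron, so it is its own expansion, and a coarse
   shape morphism S -> X amounts to a family of sequences in the homotopy groups
   [S, X_l], compatible and taken up to eventual equality. The group laws and their
   continuity are then those of [S, X_l], applied termwise.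

   For (a), a morphism r : X_l' -> X_l'' witnessing movability of (X_l) induces
   r_* : Sh(S, X_l') -> Sh(S, X_l''), which witnesses movability of (Sh(S, X_l)).

   For (b), X_l is its own expansion, so Sh(S, X_l) is discrete; being compact, it is
   finite. But two distinct elements of [S, X_l] would give infinitely many sequences
   no two of which are eventually equal. Hence [S, X_l] is trivial, all the spaces
   Sh(S, X_l) are points, and so is Sh(S, X). *)

Require Import Defs.
From mathcomp Require Import all_boot all_order all_algebra finmap generic_quotient.
From mathcomp Require Import ring lra.
From mathcomp Require Import all_classical reals topology normedtype.

Set Implicit Arguments.
Unset Strict Implicit.
Unset Printing Implicit Defensive.

Import Order.TTheory GRing.Theory Num.Theory numFieldNormedType.Exports.
(* Defs.coord has been shadowed by vector.coord. *)
Import Defs.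
Local Open Scope classical_set_scope.
Local Open Scope quotient_scope.
Local Open Scope ring_scope.

(** * Homotopies of maps out of the sphere *)

Section real_valued.
Variables (R : realType) (T : topologicalType).
Implicit Types u v : T -> R.

Lemma addr_continuous u v :
  continuous u -> continuous v -> continuous (fun t => u t + v t).
Proof. by move=> cu cv t; apply: (@cvgD _ R^o); [exact: cu|exact: cv]. Qed.

Lemma oppr_continuous u : continuous u -> continuous (fun t => - u t).
Proof. by move=> cu t; apply: (@cvgN _ R^o); exact: cu. Qed.

Lemma mulr_continuous u v :
  continuous u -> continuous v -> continuous (fun t => u t * v t).
Proof. by move=> cu cv t; apply: (@cvgM R); [exact: cu|exact: cv]. Qed.

Lemma minr_continuous u v :
  continuous u -> continuous v -> continuous (fun t => Num.min (u t) (v t)).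
Proof. by move=> cu cv t; apply: continuous_min; [exact: cu|exact: cv]. Qed.

Lemma maxr_continuous u v :
  continuous u -> continuous v -> continuous (fun t => Num.max (u t) (v t)).
Proof. by move=> cu cv t; apply: continuous_max; [exact: cu|exact: cv]. Qed.

End real_valued.

Ltac arith_continuous := repeat match goal with
  | |- continuous (fun _ => ?c) => exact: cst_continuous
  | |- continuous fst => exact: fst_continuous
  | |- continuous snd => exact: snd_continuous
  | |- continuous (fun z => @GRing.add _ _ _) => apply: addr_continuous
  | |- continuous (fun z => @GRing.opp _ _) => apply: oppr_continuous
  | |- continuous (fun z => @GRing.mul _ _ _) => apply: mulr_continuous
  | |- continuous (fun z => Num.min _ _) => apply: minr_continuous
  | |- continuous (fun z => Num.max _ _) => apply: maxr_continuous
  end.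

(* R is locally compact, so that currying into the compact-open topology and back
   preserves continuity. *)
Lemma quotient_homotopy_continuous (R : realType) (T Y : topologicalType)
    (Q0 : quotType T) (H : R * quotient_topology Q0 -> Y) :
  continuous (fun z : R * T => H (z.1, \pi_(quotient_topology Q0) z.2)) ->
  continuous H.
Proof.
move=> cH; pose Q := quotient_topology Q0.
pose G : Q -> {compact-open, R -> Y} := fun q t => H (t, q).
have cswap (U V : topologicalType) : continuous (fun z : U * V => (z.2, z.1)).
  by apply: pair_continuous; [exact: snd_continuous|exact: fst_continuous].
have [cG cGt] : continuous (G \o \pi_Q) /\ forall x, continuous (G (\pi_Q x)).
  apply: (@continuous_curry _ _ _ (fun z : T * R => H (z.2, \pi_Q z.1))).
  move=> z; apply: (@continuous_comp _ _ _ (fun z : T * R => (z.2, z.1))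
    (fun z : R * T => H (z.1, \pi_Q z.2))); [exact: cswap|exact: cH].
have cUG : continuous (uncurry G).
  apply: continuous_uncurry.
  - exact: locally_compactR.
  - exact: Rhausdorff.
  - exact: (iffRL (@quotient_continuous _ Q0 {compact-open, R -> Y} G) cG).
  - by move=> q; rewrite -[q]reprK; exact: cGt.
rewrite (_ : H = uncurry G \o fun z => (z.2, z.1)); last by apply/funext => -[].
by move=> z; apply: continuous_comp; [exact: cswap|exact: cUG].
Qed.

(** * Reparametrizations of the first coordinate of the cube *)

Section reparametrization.
Variables (R : realType) (k : nat).
Local Notation S := (sphere R k.+1).
Local Notation cube := (cube R k.+1).

Definition clamp (x : R) : R := Num.max 0 (Num.min 1 x).

Lemma clamp01 x : 0 <= clamp x <= 1.
Proof. by rewrite le_max lexx/= ge_max ler01 ge_min lexx. Qed.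

Lemma clamp_id x : 0 <= x <= 1 -> clamp x = x.
Proof. by move=> /andP[x0 x1]; rewrite /clamp (min_r x1) max_r. Qed.

Lemma clamp_le0 x : x <= 0 -> clamp x = 0.
Proof. by move=> x0; rewrite /clamp max_l// ge_min x0 orbT. Qed.

Lemma clamp_ge1 x : 1 <= x -> clamp x = 1.
Proof. by move=> x0; rewrite /clamp min_l// max_r. Qed.

Lemma clamp_continuous : continuous clamp.
Proof.
apply: maxr_continuous; first exact: cst_continuous.
by apply: minr_continuous; [exact: cst_continuous|move=> x; exact: cvg_id].
Qed.

Lemma set_first_subproof (s : cube) (x : R) (i : 'I_k.+1) :
  0 <= (if i == ord0 then clamp x else coord s i) <= 1.
Proof. by case: ifP => _; [exact: clamp01|exact: coord01]. Qed.

(** Truncation admits arbitrary real values of [x]: those outside ]0, 1[ land on the boundary, hence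
    on the base point of the sphere. *)
Definition set_first (s : cube) (x : R) : cube := mk_cube (set_first_subproof s x).

Lemma cubeP (s t : cube) : coord s =1 coord t -> s = t.
Proof.
move=> st; apply: val_inj; apply/rowP => i; exact: st.
Qed.

Lemma set_first0 s x : coord (set_first s x) ord0 = clamp x.
Proof. by rewrite coord_mk eqxx. Qed.

Lemma set_firstK s x y : set_first (set_first s x) y = set_first s y.
Proof. by apply: cubeP => i; rewrite !coord_mk; case: eqP. Qed.

Lemma set_first_id s : set_first s (coord s ord0) = s.
Proof.
by apply: cubeP => i; rewrite coord_mk; case: eqP => // ->; rewrite clamp_id// coord01.
Qed.

Lemma set_first_le0 s x : x <= 0 -> \pi_S (set_first s x) = point.
Proof.
move=> x0; apply/pi_boundary/existsP; exists ord0.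
by rewrite set_first0 clamp_le0// eqxx.
Qed.

Lemma set_first_ge1 s x : 1 <= x -> \pi_S (set_first s x) = point.
Proof.
move=> x0; apply/pi_boundary/existsP; exists ord0.
by rewrite set_first0 clamp_ge1// eqxx orbT.
Qed.

Lemma set_first_boundary s x : cube_boundary s -> x <= 0 \/ 1 <= x \/ 0 < coord s ord0 < 1 ->
  \pi_S (set_first s x) = point.
Proof.
move=> /existsP[i bi] [|[]]; [exact: set_first_le0|exact: set_first_ge1|move=> s01].
apply/pi_boundary/existsP; exists i; rewrite coord_mk; case: (i =P ord0) => [i0|_//].
by case/orP : bi; rewrite i0 => /eqP e; rewrite e ltxx ?andbF in s01.
Qed.

Lemma set_first_continuous (T : topologicalType) (u : T -> cube) (x : T -> R) :
  continuous u -> continuous x -> continuous (fun t => set_first (u t) (x t)).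
Proof.
move=> cu cx; apply: cube_continuous => i; under eq_fun do rewrite coord_mk.
case: eqP => _ t.
  by apply: (@continuous_comp _ _ _ x clamp); [exact: cx|exact: clamp_continuous].
apply: (@continuous_comp _ _ _ u ((@coord R k.+1)^~ i)); first exact: cu.
exact: coord_continuous_cube.
Qed.

(* The first coordinate of a boundary point may be interior to [0, 1], in which
   case any reparametrization keeps the point on the boundary. *)
Lemma pi_set_first (phi : R -> R) (s t : cube) :
  (phi 0 <= 0 \/ 1 <= phi 0) -> (phi 1 <= 0 \/ 1 <= phi 1) ->
  \pi_S s = \pi_S t ->
  \pi_S (set_first s (phi (coord s ord0))) = \pi_S (set_first t (phi (coord t ord0))).
Proof.
move=> p0 p1 /eqP; rewrite sphereP => /orP[/eqP->//|/andP[bs bt]].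
have H (u : cube) : cube_boundary u -> \pi_S (set_first u (phi (coord u ord0))) = point.
  move=> bu; apply: set_first_boundary => //.
  have /andP[] := coord01 u ord0; rewrite le_eqVlt => /predU1P[<- _|c0].
    by case: p0 => ?; [left|right; left].
  rewrite le_eqVlt => /predU1P[->|c1]; first by case: p1 => ?; [left|right; left].
  by right; right; rewrite c0.
by rewrite !H.
Qed.

(** The homotopy applies [f] after moving the first coordinate by [phi t]. The conditions on
    [phi t 0] and [phi t 1] send the two end faces to the base point, so that it descends to the
    sphere. Each group law then reduces to a choice of [phi]. *)
Lemma reparam_homotopy (X : ptopologicalType) (phi : R -> R -> R) (f g h : ptmap S X) :
  continuous (fun z : R * R => phi z.1 z.2) ->
  (forall t, 0 <= t <= 1 -> phi t 0 <= 0 \/ 1 <= phi t 0) ->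
  (forall t, 0 <= t <= 1 -> phi t 1 <= 0 \/ 1 <= phi t 1) ->
  (forall s x, 0 <= x <= 1 -> g (\pi_S (set_first s x)) = f (\pi_S (set_first s (phi 0 x)))) ->
  (forall s x, 0 <= x <= 1 -> h (\pi_S (set_first s x)) = f (\pi_S (set_first s (phi 1 x)))) ->
  phomotopic R g h.
Proof.
move=> cphi p0 p1 gE hE.
(* Truncating the time gives a map continuous on all of R and not only over [0, 1], as
   [quotient_homotopy_continuous] requires. *)
pose H0 (z : R * cube) := f (\pi_S (set_first z.2 (phi (clamp z.1) (coord z.2 ord0)))).
pose H (z : R * S) := H0 (z.1, repr z.2).
have HE t s : H (t, \pi_S s) = H0 (t, s).
  congr (f _); apply: (@pi_set_first (phi (clamp t))); rewrite ?reprK//.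
    by apply: p0; exact: clamp01.
  by apply: p1; exact: clamp01.
have repE (u : ptmap S X) (t : R) : 0 <= t <= 1 ->
    (forall s x, 0 <= x <= 1 -> u (\pi_S (set_first s x)) = f (\pi_S (set_first s (phi t x)))) ->
    forall y, H (t, y) = u y.
  move=> t01 uE y; rewrite -[y]reprK HE -{2}[repr y]set_first_id uE ?coord01//.
  by rewrite /H0/= clamp_id.
exists H; split.
- apply: continuous_subspaceT; apply: quotient_homotopy_continuous.
  have -> : (fun z : R * cube => H (z.1, \pi_S z.2)) = H0.
    by apply/funext => -[t s]; exact: HE.
  move=> z; apply: continuous_comp; last exact: ptmap_continuous.
  apply: continuous_comp; last exact: pi_continuous.
  apply: set_first_continuous; first exact: snd_continuous.
  move=> w; apply: (continuous_comp (f := fun z : R * cube => (clamp z.1, coord z.2 ord0))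
    (g := fun z : R * R => phi z.1 z.2)).
    apply: pair_continuous => v.
      by apply: (@continuous_comp _ _ _ fst clamp); [exact: fst_continuous|exact: clamp_continuous].
    apply: (@continuous_comp _ _ _ snd ((@coord R k.+1)^~ ord0)); first exact: snd_continuous.
    exact: coord_continuous_cube.
  exact: cphi.
- by apply: repE => //; rewrite lexx ler01.
- by apply: repE => //; rewrite lexx ler01.
(* The base point is the class of the origin, so the condition on [phi t 0] applies. *)
- move=> t _; rewrite HE /H0/=; apply: etrans (ptmap_point f); congr (f _).
  rewrite coord_mk /=; have := p0 _ (clamp01 t).
  by case; [exact: set_first_le0|exact: set_first_ge1].
Qed.

Lemma reparam_set_first a b (s : cube) : reparam a b s = set_first s (a * coord s ord0 + b).
Proof. by apply: cubeP => i; rewrite !coord_mk; case: eqP => // ->. Qed.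

(** The sum is evaluated at the representative [repr], which can differ from [set_first s x] only on
    the boundary; there all branches give the base point. *)
Lemma sphere_sumE (X : ptopologicalType) (f g : ptmap S X) s x : 0 <= x <= 1 ->
  sphere_sum f g (\pi_S (set_first s x)) =
  if x <= 2^-1 then f (\pi_S (set_first s (2 * x)))
  else g (\pi_S (set_first s (2 * x - 1))).
Proof.
move=> x01; have e0 : coord (set_first s x) ord0 = x by rewrite set_first0 clamp_id.
rewrite /= /sphere_sum_fun; case: piP => t /eqP; rewrite sphereP.
case/orP => [/eqP <-|/andP[bs bt]].
  by rewrite e0 !reparam_set_first !set_firstK e0 addr0.
have pt (u : cube) (b : R) : b = 0 \/ b = -1 -> cube_boundary u ->
    \pi_S (reparam 2 b u) = point.
  by move=> hb bu; apply/pi_boundary; exact: reparam_boundary.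
have := pt _ 0 (or_introl erefl) bs; have := pt _ (-1) (or_intror erefl) bs.
rewrite !reparam_set_first !set_firstK e0 addr0 => -> ->.
by rewrite -!reparam_set_first !pt ?ptmap_point ?if_same//; [right|left].
Qed.

Definition flip_fun (z : S) : S := \pi_S (set_first (repr z) (1 - coord (repr z) ord0)).

Lemma flipE s x : 0 <= x <= 1 ->
  flip_fun (\pi_S (set_first s x)) = \pi_S (set_first s (1 - x)).
Proof.
move=> x01; rewrite /flip_fun (@pi_set_first (fun y => 1 - y) _ (set_first s x)).
- by rewrite set_first0 clamp_id// set_firstK.
- by rewrite subr0; right.
- by rewrite subrr; left.
- by rewrite reprK.
Qed.

Lemma flip_continuous : continuous flip_fun.
Proof.
apply: (@repr_comp_continuous _ _ _ (\pi_S \o fun s => set_first s (1 - coord s ord0))).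
  move=> s; apply: (@continuous_comp _ _ _ (fun s => set_first s (1 - coord s ord0)) \pi_S);
    last exact: pi_continuous.
  apply: set_first_continuous; first by move=> ?; exact: cvg_id.
  rewrite (_ : (fun t => _) = fun t : cube => -1 * coord t ord0 + 1).
    by apply: affine_continuous; exact: coord_continuous_cube.
  by apply/funext => t; ring.
move=> s t /eqP st; apply/eqP.
by apply: (@pi_set_first (fun y => 1 - y)) => //; rewrite ?subr0 ?subrr; [right|left].
Qed.

Lemma flip_point : flip_fun point = point.
Proof.
have -> : (point : S) = \pi_S (set_first point 0) by rewrite set_first_le0.
by rewrite flipE ?lexx ?ler01// subr0 set_first_ge1// set_first_le0.
Qed.

Definition flip : ptmap S S := PtMap flip_continuous flip_point.

(** * The group laws up to homotopy *)

Section group_laws.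
Variable X : ptopologicalType.
Implicit Types f g h : ptmap S X.

Local Notation L f s x := (f (\pi_S (set_first s x))).


Let L_le0 f s x : x <= 0 -> L f s x = point.
Proof. by move=> /set_first_le0 ->; exact: ptmap_point. Qed.

Let L_ge1 f s x : 1 <= x -> L f s x = point.
Proof. by move=> /set_first_ge1 ->; exact: ptmap_point. Qed.

(** The second sum is the first one reparametrized by a concave piecewise linear map, joined to the
    identity by a straight line. Writing that map as the minimum of its linear pieces makes its
    continuity immediate. *)
Lemma sphere_sumA f g h :
  phomotopic R (sphere_sum f (sphere_sum g h)) (sphere_sum (sphere_sum f g) h).
Proof.
(* psi takes the breakpoints 1/4, 1/2 of (f + g) + h to those of f + (g + h). *)
pose psi (x : R) := Num.min (2 * x) (Num.min (x + 4^-1) (2^-1 * x + 2^-1)).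
pose phi (t x : R) := (1 - t) * x + t * psi x.
have psi0 : psi 0 = 0 by rewrite /psi !mulr0 !add0r min_l// le_min; lra.
have psi1 : psi 1 = 1 by rewrite /psi min_r !minEle; repeat case: ifP; lra.
apply: (@reparam_homotopy _ phi (sphere_sum f (sphere_sum g h))).
- by rewrite /phi /psi; arith_continuous.
- by move=> t _; rewrite /phi psi0; left; lra.
- by move=> t _; rewrite /phi psi1; right; lra.
- by move=> s x x01; congr (_ (\pi_S (set_first _ _))); rewrite /phi; ring.
- move=> s x /andP[x0 x1].
  have -> : phi 1 x = psi x by rewrite /phi; ring.
  have p01 : 0 <= psi x <= 1.
    by apply/andP; split; rewrite /psi !minEle; repeat case: ifP; lra.
  rewrite (@sphere_sumE _ f (sphere_sum g h) s _ p01).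
  rewrite (@sphere_sumE _ (sphere_sum f g) h s x); last by rewrite x0.
  have [x4|x4] := leP x 4^-1.
    have e : psi x = 2 * x by rewrite /psi min_l// le_min; lra.
    rewrite e ifT; last lra.
    rewrite ifT; last lra.
    rewrite sphere_sumE; last lra.
    by rewrite ifT; last lra.
  have [x2|x2] := leP x 2^-1.
    have e : psi x = x + 4^-1 by rewrite /psi min_r ?min_l// ?ge_min; lra.
    rewrite e ifN; last by rewrite -ltNge; lra.
    rewrite sphere_sumE; last lra.
    rewrite ifN; last by rewrite -ltNge; lra.
    rewrite sphere_sumE; last lra.
    rewrite ifT; last lra.
    by congr (_ (\pi_S (set_first _ _))); lra.
  have e : psi x = 2^-1 * x + 2^-1 by rewrite /psi min_r ?min_r// ?ge_min; lra.
  rewrite e ifN; last by rewrite -ltNge; lra.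
  rewrite sphere_sumE; last lra.
  rewrite ifN; last by rewrite -ltNge; lra.
  by congr (_ (\pi_S (set_first _ _))); lra.
Qed.

(** At time 0, [2 * x - 1] is negative on the first half, which truncation sends to the base
    point. *)
Lemma sphere_sum0l f : phomotopic R (sphere_sum (ptconst S X) f) f.
Proof.
apply: (@reparam_homotopy _ (fun t x => (1 - t) * (2 * x - 1) + t * x) f).
- by arith_continuous.
- by move=> t t01; left; lra.
- by move=> t t01; right; lra.
- move=> s x x01; rewrite sphere_sumE// subr0 mul1r mul0r addr0.
  by case: ifPn => // x2; rewrite (L_le0 f)//; lra.
- by move=> s x x01; congr (_ (\pi_S (set_first _ _))); lra.
Qed.

(** At time 0, [2 * x] exceeds 1 on the second half, which truncation sends to the base point. *)
Lemma sphere_sum0r f : phomotopic R (sphere_sum f (ptconst S X)) f.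
Proof.
apply: (@reparam_homotopy _ (fun t x => (1 - t) * (2 * x) + t * x) f).
- by arith_continuous.
- by move=> t t01; left; lra.
- by move=> t t01; right; lra.
- move=> s x x01; rewrite sphere_sumE// subr0 mul1r mul0r addr0.
  by case: ifPn => // x2; rewrite (L_ge1 f)//; lra.
- by move=> s x x01; congr (_ (\pi_S (set_first _ _))); lra.
Qed.

Definition sphere_opp f : ptmap S X := ptcomp f flip.

Lemma sphere_oppE f s x : 0 <= x <= 1 -> L (sphere_opp f) s x = L f s (1 - x).
Proof. by move=> x01; rewrite /= flipE. Qed.

Lemma sphere_oppK f : sphere_opp (sphere_opp f) = f.
Proof.
apply: ptmapP => z; rewrite -[z]reprK -(set_first_id (repr z)).
move: (coord _ _) (coord01 (repr z) ord0) => x x01.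
rewrite (sphere_oppE (sphere_opp f) _ x01) (sphere_oppE f); last lra.
by congr (f (\pi_S (set_first _ _))); lra.
Qed.

(** The sum follows [f] along [|2 * x - 1|], from 1 down to 0 and back. Cutting this path off below
    the level [t] retracts it to its end 1, where [f] takes the base point. *)
Lemma sphere_sumNl f : phomotopic R (sphere_sum (sphere_opp f) f) (ptconst S X).
Proof.
apply: (@reparam_homotopy _ (fun t x => Num.max t (Num.max (1 - 2 * x) (2 * x - 1))) f).
- by arith_continuous.
- by move=> t t01; right; rewrite !le_max mulr0 subr0 lexx orbT.
- move=> t t01; right; rewrite !le_max mulr1.
  by rewrite (_ : (2 : R) - 1 = 1) ?lexx ?orbT//; lra.
- move=> s x x01; rewrite sphere_sumE//; case: ifPn => [x2|].
    rewrite sphere_oppE; last lra.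
    rewrite [X in Num.max _ X]max_l; last lra.
    by rewrite max_r//; lra.
  rewrite -ltNge => x2.
  rewrite [X in Num.max _ X]max_r; last lra.
  by rewrite max_r//; lra.
- by move=> s x x01; rewrite (L_ge1 f)// le_max lexx.
Qed.

Lemma sphere_sumNr f : phomotopic R (sphere_sum f (sphere_opp f)) (ptconst S X).
Proof. by rewrite -{1}[f]sphere_oppK; exact: sphere_sumNl. Qed.

End group_laws.

End reparametrization.

Section homotopy_group.
Variables (R : realType) (k : nat) (X : ptopologicalType).
Local Notation S := (sphere R k.+1).
Implicit Types f g h : htop R S X.

Lemma haddA f g h : hadd f (hadd g h) = hadd (hadd f g) h.
Proof.
rewrite -[f]hreprK -[g]hreprK -[h]hreprK !haddE; apply/hclassP.
exact: sphere_sumA.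
Qed.

Lemma hadd0l f : hadd (hconst R S X) f = f.
Proof.
by rewrite -[f]hreprK /hconst haddE; apply/hclassP; exact: sphere_sum0l.
Qed.

Lemma hadd0r f : hadd f (hconst R S X) = f.
Proof.
by rewrite -[f]hreprK /hconst haddE; apply/hclassP; exact: sphere_sum0r.
Qed.

Definition hopp f : htop R S X := hcomp f (hclass R (flip R k)).

Lemma haddNl f : hadd (hopp f) f = hconst R S X.
Proof.
rewrite -[f]hreprK /hopp hcompE haddE; apply/hclassP.
exact: sphere_sumNl.
Qed.

Lemma haddNr f : hadd f (hopp f) = hconst R S X.
Proof.
rewrite -[f]hreprK /hopp hcompE haddE; apply/hclassP.
exact: sphere_sumNr.
Qed.

End homotopy_group.

(** * The sphere as the boundary of a simplex *)

Section finite_realization.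
Variables (R : realType) (V : finType) (K : scomplex V).

Lemma realizationP (x y : realization R K) : bary x =1 bary y -> x = y.
Proof.
case: x y => [x Hx] [y Hy] /= /funext xy; subst y.
by congr Realization; exact: Prop_irrelevance.
Qed.

Lemma bary_continuous (v : V) : continuous (fun x : realization R K => x v).
Proof.
apply/continuousP => O oO; rewrite /open/= => s Ks.
exists ((fun y : {ptws V -> R} => y v) @^-1` O); split => //.
have cp : continuous (fun y : {ptws V -> R} => y v) by exact: (@proj_continuous V (fun=> R) v).
by move/continuousP : cp; apply.
Qed.

Lemma realization_hausdorff : hausdorff_space (realization R K).
Proof.
move=> x y xy; apply: realizationP => v; apply: (@Rhausdorff R) => A B Ax By.
have [z [Az Bz]] := xy _ _ (bary_continuous (v := v) Ax) (bary_continuous (v := v) By).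
by exists (z v).
Qed.

(** Over a finite vertex set the weak topology is tested on finitely many faces: the preimage of a
    closed set is a finite union of closed sets, one for each possible face. *)
Lemma realization_continuous (T : topologicalType) (f : T -> realization R K) :
  (forall v, continuous (fun t => f t v)) -> continuous f.
Proof.
move=> cf; apply/continuous_closedP => C.
rewrite -openC /open/= => oC.
pose W (s : {fset V}) (Ks : K s) := projT1 (cid (oC s Ks)).
have cg : continuous (fun t => bary (f t) : {ptws V -> R}).
  move=> t; apply/cvg_sup => v; move: t.
  apply/(@continuousP _ (initial_topology (fun g : V -> R => g v))) => _ [B oB <-].
  rewrite -[_ @^-1` _]/((fun t => f t v) @^-1` B).
  by move/continuousP : (cf v); apply.
(* [W] depends on the proof of [K s], so [D s] quantifies over that proof and is empty when [s] is
   not a simplex. *)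
pose D (s : {fset V}) : set T := [set t | exists Ks : K s,
  ~ W s Ks (bary (f t)) /\ forall v, v \notin s -> f t v = 0].
rewrite (_ : f @^-1` C = \bigcup_(s in [set: {fset V}]) D s); last first.
  apply/seteqP; split => t /=.
    move=> Cft; have [s [Ks _ fs _]] := baryP (f t).
    exists s => //; exists Ks; split => //.
    rewrite /W; case: cid => U /= [_ UE] Ut; have : (~` C) (f t) by apply/(UE _ fs).
    exact.
  move=> [s _ [Ks []]]; rewrite /W; case: cid => U /= [_ UE] nU fs.
  by apply: contrapT => nC; apply: nU; apply/(UE _ fs).
apply: closed_bigcup => [|s _]; first exact: finite_finset.
have [Ks|nKs] := pselect (K s); last first.
  by rewrite (_ : D s = set0) ?predeqE; [exact: closed0|split => // -[]].
rewrite (_ : D s = (fun t => bary (f t) : {ptws V -> R}) @^-1` (~` W s Ks) `&`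
    \bigcap_(v in [set v | v \notin s]) ((fun t => f t v) @^-1` [set 0])).
  apply: closedI.
    move/continuous_closedP : cg; apply; apply: open_closedC.
    by rewrite /W; case: cid => U /= [].
  apply: closed_bigI => v _; move/continuous_closedP : (cf v); apply.
  exact: closed_eq.
apply/seteqP; split => t /=.
  by move=> [Ks']; rewrite (Prop_irrelevance Ks' Ks) => -[].
by move=> [nW fs]; exists Ks; split => // v /fs.
Qed.

End finite_realization.

Lemma compact_hausdorff_homeomorphic (S T : topologicalType) (f : S -> T) :
  compact [set: S] -> hausdorff_space T -> continuous f -> bijective f ->
  homeomorphic S T.
Proof.
move=> cS hT cf [g fK gK]; exists f, g; split => //.
apply/continuous_closedP => C cC.
rewrite (_ : g @^-1` C = f @` C).
  apply: compact_closed => //; apply: continuous_compact.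
    exact: continuous_subspaceT.
  exact: subclosed_compact cC cS _.
apply/seteqP; split => [t /= Ct|_ [s Cs <-]]; last by rewrite /= fK.
by exists (g t).
Qed.

(** The cube, a subtype, is the image of a compact box of row vectors under coordinatewise
    truncation, which is defined on all row vectors. *)
Lemma cube_compact (R : realType) k : compact [set: cube R k].
Proof.
have sub (v : 'rV[R]_k) i : 0 <= clamp (v ord0 i) <= 1 by exact: clamp01.
pose r (v : 'rV[R]_k) : cube R k := mk_cube (sub v).
have cr : continuous r.
  apply: cube_continuous => i; under eq_fun do rewrite coord_mk.
  move=> v; apply: (@continuous_comp _ _ _ (fun v : 'rV[R]_k => v ord0 i) (@clamp R)).
    exact: coord_continuous.
  exact: clamp_continuous.
pose I01 (i : 'I_k) : set R := [set` `[0, 1]].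
rewrite (_ : [set: _] = r @` [set v : 'rV[R]_k | forall i, I01 i (v ord0 i)]).
  apply: continuous_compact; first exact: continuous_subspaceT.
  apply: (@rV_compact R k I01) => i; exact: segment_compact.
apply/seteqP; split => // s _ /=.
exists (set_val s) => [i|]; first by rewrite /I01/= in_itv/=; exact: (coord01 s i).
apply: val_inj; apply/rowP => i; rewrite mxE clamp_id//; exact: (coord01 s i).
Qed.

Lemma sphere_compact (R : realType) k : compact [set: sphere R k].
Proof.
rewrite (_ : [set: _] = \pi_(sphere R k) @` [set: cube R k]).
  apply: continuous_compact; last exact: cube_compact.
  exact/continuous_subspaceT/pi_continuous.
by apply/seteqP; split => // z _; exists (repr z) => //; exact: reprK.
Qed.

Section simplex_boundary.
Variables (R : realType) (V : finType).
Hypothesis V2 : forall v : V, exists v', v' != v.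

Let bd_simplex (s : {fset V}) : Prop := s != fset0 /\ exists v, v \notin s.

Lemma bd_simplex0 : ~ bd_simplex fset0.
Proof. by case; rewrite eqxx. Qed.

Lemma bd_simplex1 v : bd_simplex [fset v]%fset.
Proof.
split; last by have [v' vv'] := V2 v; exists v'; rewrite inE.
by apply/fset0Pn; exists v; rewrite inE.
Qed.

Lemma bd_simplex_sub (s t : {fset V}) :
  bd_simplex s -> (t `<=` s)%fset -> t != fset0 -> bd_simplex t.
Proof.
move=> [_ [v vs]] ts t0; split => //; exists v; apply: contra vs.
exact: (fsubsetP ts).
Qed.

Definition simplex_boundary : scomplex V :=
  SComplex bd_simplex0 bd_simplex1 bd_simplex_sub.

Definition bd_point (z : V -> R) : Prop :=
  [/\ forall v, 0 <= z v, exists v, z v = 0 & \sum_v z v = 1].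

Let sum_support (z : V -> R) (s : {fset V}) :
  (forall v, v \notin s -> z v = 0) -> \sum_(v <- s) z v = \sum_v z v.
Proof.
move=> zs; rewrite big_uniq ?fset_uniq//= big_mkcond/=.
by apply: eq_bigr => v _; case: ifPn => // /zs.
Qed.

Lemma bd_pointP (x : realization R simplex_boundary) : bd_point (bary x).
Proof.
have [s [[_ [v vs]] x0 xs]] := baryP x; rewrite sum_support// => x1.
by split => //; exists v; exact: xs.
Qed.

Lemma bd_realization_subproof (z : V -> R) : bd_point z ->
  exists s : {fset V}, [/\ simplex_boundary s, forall v, 0 <= z v,
    forall v, v \notin s -> z v = 0 & \sum_(v <- s) z v = 1].
Proof.
(* The facet opposite to a vertex where [z] vanishes. *)
move=> [z0 [v zv] z1]; exists [fset w in enum V | w != v]%fset.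
have zs w : w \notin [fset w in enum V | w != v]%fset -> z w = 0.
  by rewrite !inE mem_enum /= negbK => /eqP ->.
split => //; last by rewrite sum_support.
split; last by exists v; rewrite !inE eqxx andbF.
by have [w wv] := V2 v; apply/fset0Pn; exists w; rewrite !inE mem_enum.
Qed.

Definition bd_realization (z : V -> R) (Hz : bd_point z) :
  realization R simplex_boundary := Realization (bd_realization_subproof Hz).

End simplex_boundary.

(* Directions of R^V modulo the constants: w is replaced by the positive multiple
   of w - min w with sum 1, where the coordinate at v0 is used to represent the
   class of w by w v0 = 0. *)
Section direction.
Variables (R : realType) (V : finType) (v0 : V).
Implicit Types w z : V -> R.

(** The default 0 is harmless: under the normalization [w v0 = 0] it is one of the values of [w]. *)
Definition low w : R := \big[Num.min/0]_v w v.

Definition total w : R := \sum_v (w v - low w).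

Definition direction w : V -> R := fun v => (w v - low w) / total w.

Lemma low_le w v : low w <= w v. Proof. exact: bigmin_le. Qed.

Lemma lowE w c : w v0 = 0 -> (forall v, c <= w v) -> (exists v, w v = c) -> low w = c.
Proof.
move=> w0 cw [v wv]; apply/le_anti; rewrite -{1}wv low_le/=.
by apply/bigmin_geP; rewrite -{1}w0 cw.
Qed.

Lemma low_attained w : w v0 = 0 -> exists v, w v = low w.
Proof.
move=> w0; have [v _ vmin] := @arg_minP _ _ _ v0 xpredT w isT.
by exists v; apply/esym/lowE => //; [move=> u; exact: vmin|exists v].
Qed.

(** A sum of nonnegative terms that vanishes only for constant [w], and the constant would be
    [w v0 = 0]. *)
Lemma total_gt0 w v : w v0 = 0 -> w v != 0 -> 0 < total w.
Proof.
move=> w0 wv; rewrite lt_def sumr_ge0 ?andbT; last by move=> u _; rewrite subr_ge0 low_le.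
apply: contra wv; rewrite psumr_eq0; last by move=> u _; rewrite subr_ge0 low_le.
move=> /allP H; have := H v0; have := H v; rewrite !mem_index_enum => /(_ isT) /= + /(_ isT).
by rewrite !subr_eq0 w0 => /eqP -> /eqP <-.
Qed.

Lemma direction_bd_point w v : w v0 = 0 -> w v != 0 -> bd_point (direction w).
Proof.
move=> w0 /(total_gt0 w0) t0; split.
- by move=> u; rewrite divr_ge0 ?(ltW t0)// subr_ge0 low_le.
- by have [u wu] := low_attained w0; exists u; rewrite /direction wu subrr mul0r.
- by rewrite -mulr_suml divff// gt_eqF.
Qed.

(** Equal directions give [w - low w = c * (w' - low w')]; at [v0] this reads [low w = c * low w'],
    and the constants cancel. *)
Lemma direction_inj w w' u u' : w v0 = 0 -> w' v0 = 0 -> w u != 0 -> w' u' != 0 ->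
  direction w =1 direction w' -> exists2 c, 0 < c & forall v, w v = c * w' v.
Proof.
move=> w0 w0' /(total_gt0 w0) t0 /(total_gt0 w0') t0' ww'.
exists (total w / total w'); first exact: divr_gt0.
have E v : w v - low w = total w / total w' * (w' v - low w').
  have := ww' v; rewrite /direction => /(congr1 ( *%R (total w))).
  by rewrite mulrCA divff ?gt_eqF// mulr1 mulrCA mulrC => ->; ring.
move=> v; have := E v; have := E v0; rewrite w0 w0' => e0 ev.
by apply: (addIr (- low w)); rewrite ev -[- low w]add0r e0; ring.
Qed.

(** This yields surjectivity. The minimum is [- (t * z v0)] because [z] vanishes somewhere, and the
    total is [t] because [z] has sum 1. *)
Lemma directionE w z t : 0 < t -> bd_point z -> (forall v, w v = t * (z v - z v0)) ->
  direction w =1 z.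
Proof.
move=> t0 [z0 [u zu] z1] wE.
have lE : low w = - (t * z v0).
  apply: lowE; first by rewrite wE subrr mulr0.
    by move=> v; rewrite wE mulrBr lerDr mulr_ge0// ltW.
  by exists u; rewrite wE zu; ring.
have E v : w v - low w = t * z v by rewrite lE wE; ring.
have tE : total w = t by rewrite /total; under eq_bigr do rewrite E; rewrite -mulr_sumr z1 mulr1.
by move=> v; rewrite /direction E tE mulrAC divff ?mul1r// gt_eqF.
Qed.

Lemma direction_continuous (T : topologicalType) (w : T -> V -> R) :
  (forall v, continuous (fun t => w t v)) ->
  (forall t, w t v0 = 0) -> (forall t, exists v, w t v != 0) ->
  forall v, continuous (fun t => direction (w t) v).
Proof.
move=> cw w0 wn0.
have cl : continuous (fun t => low (w t)).
  apply: (@continuous_big R V Num.min 0 xpredT _ T _ (fun v t => w t v)) => //.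
  exact: min_continuous.
have cd v : continuous (fun t => w t v - low (w t)).
  by move=> t; apply: (@cvgB _ R^o); [exact: cw|exact: cl].
have ct : continuous (fun t => total (w t)).
  apply: (@continuous_big R V +%R 0 xpredT _ T _ (fun v t => w t v - low (w t))) => //.
  by move=> z; apply: (@cvgD _ R^o); [exact: cvg_fst|exact: cvg_snd].
move=> v t; apply: (@cvgM R); first exact: cd.
apply: (@cvgV R); last exact: ct.
have [u wu] := wn0 t; rewrite gt_eqF//; exact: total_gt0 wu.
Qed.

End direction.

(** * The sphere as the set of directions of R^V modulo constants *)

Section sphere_polyhedron.
Variables (R : realType) (k : nat).
Local Notation S := (sphere R k.+1).
Local Notation cube := (cube R k.+1).
(** With k + 3 vertices, the boundary of the simplex has dimension k + 1. [None] is the coordinate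
    normalized to 0, [Some None] the polar axis, [Some (Some i)] the remaining axes. *)
Local Notation V := (option (option 'I_k.+1)).

Lemma other_vertex (v : V) : exists v', v' != v.
Proof. by case: v => [v|]; [exists None|exists (Some None)]. Qed.

Definition centered (s : cube) i : R := 2 * coord s i - 1.

(** The sup-norm distance to the centre, scaled so that the boundary is the level 1. *)
Definition radius (s : cube) : R := \big[Num.max/0]_i `|centered s i|.

Lemma centered_le_radius s i : `|centered s i| <= radius s.
Proof. exact: le_bigmax. Qed.

Lemma centered_norm s i : `|centered s i| <= 1.
Proof. by rewrite ler_norml /centered; have := coord01 s i; lra. Qed.

Lemma radius_le1 s : radius s <= 1.
Proof. by apply/bigmax_leP; split => // i _; exact: centered_norm. Qed.

Lemma radius_ge0 s : 0 <= radius s. Proof. exact: bigmax_ge_id. Qed.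

Lemma radius_attained s : exists i, `|centered s i| = radius s.
Proof.
have [i _ imax] := @arg_maxP _ _ _ ord0 xpredT (fun i => `|centered s i|) isT.
exists i; apply/le_anti; rewrite centered_le_radius/=.
by apply/bigmax_leP; split => // j _; exact: imax.
Qed.

Lemma radius1P s : cube_boundary s <-> radius s = 1.
Proof.
split=> [/existsP[i bi]|s1].
  apply/le_anti; rewrite radius_le1/=; apply: le_trans (centered_le_radius s i).
  case/orP : bi => /eqP e; rewrite /centered e.
    by rewrite mulr0 sub0r normrN1.
  by rewrite mulr1 addrK normr1.
have [i] := radius_attained s; rewrite s1 => e; apply/existsP; exists i.
have := coord01 s i; move: e; rewrite /centered.
by case: (ger0P (2 * coord s i - 1)) => _ e _; apply/orP; [right|left]; apply/eqP; lra.
Qed.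

(* The meridian through a boundary face: the centre of the cube goes to the south
   pole, the boundary to the north pole. *)
Definition wrap (s : cube) (v : V) : R :=
  match v with
  | None => 0
  | Some None => 2 * radius s - 1
  | Some (Some i) => (1 - radius s) * centered s i
  end.

Lemma radius_continuous : continuous radius.
Proof.
apply: (@continuous_big R _ Num.max 0 xpredT _ _ _ (fun i s => `|centered s i|)) => [|i _].
  exact: max_continuous.
have cc : continuous (centered^~ i).
  by rewrite /centered; arith_continuous; exact: coord_continuous_cube.
move=> s; apply: (@continuous_comp _ R R (centered^~ i) Num.norm); first exact: cc.
exact: (@norm_continuous R R^o).
Qed.

Lemma wrap_continuous v : continuous (wrap^~ v).
Proof.
have cr := radius_continuous.
case: v => [[i|]|] /=; rewrite ?/centered; arith_continuous => //.
exact: coord_continuous_cube.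
Qed.

Lemma wrap_neq0 s : exists v, wrap s v != 0.
Proof.
have [s2|s2] := eqVneq (2 * radius s - 1) 0; last by exists (Some None).
have [i si] := radius_attained s; exists (Some (Some i)) => /=.
rewrite mulf_neq0//; first by apply/eqP => s1; lra.
by rewrite -normr_eq0 si; apply/eqP => s1; lra.
Qed.

(** Comparing the polar coordinates and the sup norms of the other ones forces [c = 1], hence equal
    radii. Off the boundary the factor [1 - radius t] then cancels. *)
Lemma wrap_inj s t c : 0 < c -> (forall v, wrap s v = c * wrap t v) -> sphere_rel s t.
Proof.
move=> c0 st; have B : 2 * radius s - 1 = c * (2 * radius t - 1) := st (Some None).
have st' i : (1 - radius s) * centered s i = c * ((1 - radius t) * centered t i).
  exact: (st (Some (Some i))).
have s1 := radius_le1 s; have t1 := radius_le1 t.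
have nst i : (1 - radius s) * `|centered s i| = c * ((1 - radius t) * `|centered t i|).
  have := congr1 Num.norm (st' i).
  rewrite !normrM (gtr0_norm c0).
  by rewrite (@ger0_norm _ (1 - radius s)) ?(@ger0_norm _ (1 - radius t)) ?subr_ge0.
have A : (1 - radius s) * radius s = c * ((1 - radius t) * radius t).
  have [i si] := radius_attained s; have [j tj] := radius_attained t.
  apply/le_anti/andP; split.
    rewrite -{2}si nst ler_pM2l// ler_wpM2l ?subr_ge0//; exact: centered_le_radius.
  rewrite -{2}tj -nst ler_wpM2l ?subr_ge0//; exact: centered_le_radius.
(* 4 (1 - N) N + (2 N - 1)^2 = 1 for N = radius s and for N = radius t. *)
have c1 : c = 1.
  have : (c - 1) * (4 * ((1 - radius t) * radius t) + (c + 1) * (2 * radius t - 1) ^+ 2) = 0.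
    transitivity (4 * (c * ((1 - radius t) * radius t)) +
      (c * (2 * radius t - 1)) ^+ 2 - 1); first by ring.
    by rewrite -A -B; ring.
  move/eqP; rewrite mulf_eq0 => /orP[/eqP|/eqP e]; first by lra.
  have t0 := radius_ge0 t; exfalso; nra.
have rst : radius s = radius t by move: B; rewrite c1; lra.
have [tb|tb] := eqVneq (radius t) 1.
  by rewrite /sphere_rel (radius1P s).2 ?(radius1P t).2 ?orbT// rst.
apply/orP; left; apply/eqP/cubeP => i.
have : (1 - radius t) * (centered s i - centered t i) = 0.
  by have := st' i; rewrite rst c1; lra.
move/eqP; rewrite mulf_eq0 subr_eq0 eq_sym (negbTE tb)/= /centered => /eqP; lra.
Qed.

(** With [q] the polar coordinate and [M] the sup norm of the others, the preimage has radius [N]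
    where [2 * N - 1 = t * q] and [(1 - N) * N = t * M]. Eliminating [N] leaves a quadratic equation
    for [t]. *)
Lemma wrap_surj (v : option 'I_k.+1 -> R) : (exists i, v i != 0) ->
  exists s t, 0 < t /\ forall i, wrap s (Some i) = t * v i.
Proof.
move=> vn0; pose q := v None.
pose M := \big[Num.max/0]_i `|v (Some i)|.
have M0 : 0 <= M by exact: bigmax_ge_id.
have leM i : `|v (Some i)| <= M by exact: le_bigmax.
have [i0 vi0] : exists i, `|v (Some i)| = M.
  have [i _ imax] := @arg_maxP _ _ _ ord0 xpredT (fun i => `|v (Some i)|) isT.
  exists i; apply/le_anti; rewrite leM/=.
  by apply/bigmax_leP; split => // j _; exact: imax.
(* t is the positive root of t^2 q^2 + 4 M t = 1. *)
pose D := Num.sqrt (4 * M ^+ 2 + q ^+ 2).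
have D2 : D ^+ 2 = 4 * M ^+ 2 + q ^+ 2.
  by rewrite sqr_sqrtr// addr_ge0 ?sqr_ge0// mulr_ge0 ?sqr_ge0 ?ler0n.
have D0 : 0 <= D by exact: sqrtr_ge0.
have r0 : 0 < 2 * M + D.
  have [j] := vn0; rewrite lt_def addr_ge0 ?mulr_ge0 ?ler0n// andbT; apply: contra => /eqP e.
  have Mz : M = 0 by lra.
  have Dz : D = 0 by lra.
  have qz : q = 0.
    by move/eqP: D2; rewrite Dz Mz !expr0n/= mulr0 add0r eq_sym sqrf_eq0 => /eqP.
  case: j => [j|]; last by rewrite -/q qz.
  by rewrite -normr_eq0; have := leM j; rewrite Mz normr_le0 => /eqP ->; rewrite normr0.
(* The rationalized form of the root, meaningful also for [q = 0]. *)
pose t := (2 * M + D)^-1.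
have t0 : 0 < t by rewrite invr_gt0.
have tE : t ^+ 2 * q ^+ 2 + 4 * M * t = 1.
  have qE : q ^+ 2 = (2 * M + D) ^+ 2 - 4 * M * (2 * M + D).
    by rewrite -[q ^+ 2](addKr (4 * M ^+ 2)) -D2; ring.
  by rewrite qE /t; field; rewrite gt_eqF.
pose N := (1 + t * q) / 2.
have tM : t * M = (1 - N) * N by rewrite /N; move: tE; rewrite -exprMn; move: (t * q) => y; nra.
have /andP[N0 N1] : 0 <= N <= 1.
  have : `|t * q| <= 1.
    rewrite -(@expr_le1 _ 2)// real_normK ?num_real// exprMn -tE lerDl.
    by rewrite !mulr_ge0// ltW.
  by rewrite ler_norml /N; lra.
(* The centered coordinates of the preimage. If [N = 1] then [M = 0], the target is the north pole,
   and any boundary point will do. *)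
pose u i := if N == 1 then 1 else t * v (Some i) / (1 - N).
have uE i : (1 - N) * u i = t * v (Some i).
  rewrite /u; case: eqP => [NE|/eqP NE]; last by rewrite mulrC divfK// subr_eq0 eq_sym.
  have : t * M = 0 by rewrite tM NE subrr mul0r.
  move/eqP; rewrite mulf_eq0 (gt_eqF t0)/= => /eqP Mz.
  have := leM i; rewrite Mz normr_le0 => /eqP ->; rewrite NE; ring.
have nu i : `|u i| <= N.
  rewrite /u; case: eqP => [->|/eqP NE]; first by rewrite normr1.
  have N1' : 0 < 1 - N by rewrite subr_gt0 lt_neqAle NE.
  rewrite normrM normfV (gtr0_norm N1') normrM (gtr0_norm t0) ler_pdivrMr//.
  by rewrite [N * _]mulrC -tM ler_wpM2l// ltW.
have nu0 : `|u i0| = N.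
  rewrite /u; case: eqP => [->|/eqP NE]; first by rewrite normr1.
  have N1' : 0 < 1 - N by rewrite subr_gt0 lt_neqAle NE.
  rewrite normrM normfV (gtr0_norm N1') normrM (gtr0_norm t0) vi0 tM mulrAC.
  by rewrite divff ?mul1r// gt_eqF.
have u01 i : 0 <= (u i + 1) / 2 <= 1.
  by have := nu i; rewrite ler_norml; lra.
have cE i : centered (mk_cube u01) i = u i by rewrite /centered coord_mk; lra.
have rE : radius (mk_cube u01) = N.
  apply/le_anti/andP; split.
    by apply/bigmax_leP; split => // i _; rewrite cE.
  by rewrite -nu0 -cE centered_le_radius.
exists (mk_cube u01), t; split => // -[i|] /=; rewrite rE; first by rewrite cE uE.
by rewrite /N -/q; lra.
Qed.

(** [direction] after [wrap] identifies exactly the boundary points, so it induces a continuous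
    bijection from a compact space to a Hausdorff one. *)
Lemma sphere_polyhedron : polyhedron R S.
Proof.
pose bd := simplex_boundary other_vertex.
have wP s : bd_point (direction (wrap s)).
  by have [v wv] := wrap_neq0 s; exact: (@direction_bd_point _ _ None _ v).
pose b s : realization R bd := bd_realization other_vertex (wP s).
have bP s t : b s = b t <-> sphere_rel s t.
  split=> [st|/orP[/eqP->//|/andP[/radius1P bs /radius1P bt]]].
    have [v sv] := wrap_neq0 s; have [u tu] := wrap_neq0 t.
    have wst : direction (wrap s) =1 direction (wrap t).
      by move=> i; exact: (congr1 (fun x : realization R bd => x i) st).
    have [c c0 cst] := @direction_inj _ _ None (wrap s) (wrap t) v u erefl erefl sv tu wst.
    exact: wrap_inj cst.
  apply: realizationP => v /=; congr (direction _ v); apply/funext => -[[i|]|] //=.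
    by rewrite bs bt subrr !mul0r.
  by rewrite bs bt.
have cb : continuous (b \o repr : S -> realization R bd).
  apply: repr_comp_continuous.
    apply: realization_continuous => v.
    by apply: (@direction_continuous _ _ None) => //; [exact: wrap_continuous|exact: wrap_neq0].
  by move=> s t; rewrite sphereP => /bP ->.
exists V, bd; apply: (@compact_hausdorff_homeomorphic S _ (b \o repr)) => //.
- exact: sphere_compact.
- exact: realization_hausdorff.
have surj (x : realization R bd) : exists z : S, b (repr z) = x.
  have Hx := bd_pointP x; have [_ [v xv] x1] := Hx.
  (* This vector is nonzero: otherwise all coordinates of [x] would equal the vanishing one and
     could not sum to 1. *)
  have [|s [t [t0 st]]] := @wrap_surj (fun i => x (Some i) - x None).
    apply: contrapT => /forallNP H.
    have xE u : x u = x None.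
      by case: u => // i; apply/eqP; rewrite -subr_eq0; exact/negPn/negP/H.
    have : \sum_v x v = 0 by apply: big1 => u _; rewrite xE -(xE v).
    by rewrite x1 => /eqP; rewrite oner_eq0.
  exists (\pi_S s); transitivity (b s); first by apply/bP; rewrite -sphereP reprK.
  apply: realizationP; apply: (@directionE _ _ None _ _ t t0 Hx) => -[i|]; first exact: st.
  by rewrite subrr mulr0.
pose g x := projT1 (cid (surj x)).
exists g => [z|x]; last by rewrite /g; case: cid.
by rewrite /g; case: cid => y /= /bP; rewrite -sphereP !reprK => /eqP.
Qed.

End sphere_polyhedron.

(** * Coarse shape morphisms as sequences *)

Section representatives.
Variable R : realType.

Lemma inducedP X Y (p : under R X) (q : under R Y) (h : htop R X Y) :
  HPol_expansion p -> (forall m, HPol R (q m)) -> induces h (induced p q h).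
Proof.
move=> Hp Hq; rewrite /induced; case: xgetP => [F -> //|H].
by have [F /H] := induces_exists h Hp Hq.
Qed.

Lemma induced_comp X Y Z (p : under R X) (q : under R Y) (r : under R Z)
    (h : htop R X Y) (l : htop R Y Z) :
  HPol_expansion p -> HPol_expansion q -> (forall m, HPol R (r m)) ->
  pro_comp (induced q r l) (induced p q h) = induced p r (hcomp l h).
Proof.
move=> Hp Hq Hr; apply: (induces_unique Hp Hr); last exact: inducedP.
by apply: induces_comp; apply: inducedP => //; case: Hq.
Qed.

Lemma induced_id X (p : under R X) : HPol_expansion p ->
  induced p p (hid R X) = sclass (smor_id p).
Proof.
move=> Hp; have [Hp' _ _] := Hp.
by apply: (induces_unique Hp Hp'); [exact: inducedP|exact: induces_id].
Qed.

(** The inverse composes with the canonical isomorphisms in the other direction. Hom-sets can thus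
    be computed in any expansions. *)
Lemma sh_class_bij X Y (p : under R X) (q : under R Y) :
  HPol_expansion p -> HPol_expansion q -> bijective (@sh_class R X Y p q).
Proof.
move=> Hp Hq; have [Hp' _ _] := Hp; have [Hq' _ _] := Hq.
have HX : HPol_expansion (expansion_of R X) by apply: expansion_ofP; exists p.
have HY : HPol_expansion (expansion_of R Y) by apply: expansion_ofP; exists q.
have [HX' _ _] := HX; have [HY' _ _] := HY.
exists (fun G : Sh R X Y => pro_comp (induced (expansion_of R Y) q (hid R Y))
    (pro_comp G (induced p (expansion_of R X) (hid R X)))) => F.
- rewrite /sh_class !pro_compA induced_comp// -!pro_compA induced_comp//.
  by rewrite !hcomp1l !induced_id// pro_comp1r pro_comp1l.
- rewrite /sh_class !pro_compA induced_comp// -!pro_compA induced_comp//.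
  by rewrite !hcomp1l !induced_id// pro_comp1r [LHS]pro_comp1l.
Qed.

Lemma sh_push_class X Y Z (p : under R X) (q : under R Y) (r : under R Z)
    (h : htop R Y Z) (F : prostar p q) :
  HPol_expansion q -> HPol_expansion r ->
  sh_push h (sh_class F) = sh_class (pro_comp (induced q r h) F).
Proof.
move=> Hq Hr; have [Hr' _ _] := Hr.
have HY : HPol_expansion (expansion_of R Y) by apply: expansion_ofP; exists q.
have HZ : HPol_expansion (expansion_of R Z) by apply: expansion_ofP; exists r.
have [HZ' _ _] := HZ.
rewrite /sh_push /sh_comp /sh_class /sh_htop !pro_compA !induced_comp//.
by rewrite hcomp1l hcomp1r.
Qed.

Lemma smor_proj_subproof X (p : under R X) (l : idx p)
    (m m' : idx (rud_sys R (p l))) (h : ile m m') :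
  exists l' (h1 h2 : ile l l') (n0 : nat), forall n : nat, (n0 <= n)%N ->
    hcomp (bond h) (hcomp (hid R (p l)) (bond h2)) = hcomp (hid R (p l)) (bond h1).
Proof. by exists l, (ile_refl l), (ile_refl l), 0%N => n _; rewrite !hcomp1l. Qed.

Definition smor_proj X (p : under R X) (l : idx p) : smor p (rud R (p l)) :=
  @SMor R p (rud R (p l)) (fun=> l) (fun _ _ => hid R (p l)) (@smor_proj_subproof X p l).

(** Pushing along [proj p l] therefore keeps just the sequence at the index [l]. *)
Lemma induced_proj X (p : under R X) (l : idx p) : HPol_expansion p ->
  induced p (rud R (p l)) (proj p l) = sclass (smor_proj l).
Proof.
move=> Hp; have [Hp' _ _] := Hp.
apply: (@induces_unique R _ _ p (rud R (p l)) _ _ _ Hp (fun=> Hp' l)).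
  by apply: inducedP => // -[]; exact: Hp'.
by exists (smor_proj l); split => // -[] /=; rewrite !hcomp1l.
Qed.

End representatives.

(* As A is its own expansion, a coarse shape morphism A -> X is a family of
   sequences in the sets [A, X_l], compatible and taken up to eventual equality. *)
Section sequences.
Variables (R : realType) (A X : ptopologicalType) (p : under R X).
Hypotheses (HA : HPol R A) (Hp : HPol_expansion p).
Implicit Types f g : smor (rud_sys R A) p.

Definition seq_class f : Sh R A X := sh_class (p := rud R A) (q := p) (sclass f).

Lemma seq_class_surj (F : Sh R A X) : exists f, F = seq_class f.
Proof.
have [D _ DK] := sh_class_bij (rud_expansion HA) Hp.
by exists (repr (D F)); rewrite /seq_class sreprK DK.
Qed.

(** The source system has one index and identity bonds, so of the equivalence of S^*-morphisms only
    eventual equality remains. *)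
Lemma seq_classP f g : seq_class f = seq_class g <->
  forall l, exists n0, forall n, (n0 <= n)%N -> f n l = g n l.
Proof.
have /bij_inj inj := sh_class_bij (rud_expansion HA) Hp; split.
  move=> /inj/sclassP fg l; have [a [h1 [h2 [n0 fgn]]]] := fg l.
  by exists n0 => n n0n; have := fgn _ n0n; rewrite !hcomp1r.
move=> fg; congr sh_class; apply/sclassP => l; have [n0 fgn] := fg l.
exists tt, I, I, n0 => n n0n; rewrite !hcomp1r; exact: fgn.
Qed.

Lemma sh_push_projP f g (l : idx p) :
  sh_push (proj p l) (seq_class f) = sh_push (proj p l) (seq_class g) <->
  exists n0, forall n, (n0 <= n)%N -> f n l = g n l.
Proof.
have [Hp' _ _] := Hp; have Hl := rud_expansion (Hp' l).
have /bij_inj inj := sh_class_bij (rud_expansion HA) Hl.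
rewrite /seq_class !(sh_push_class _ _ Hp Hl) induced_proj// !pro_compE; split.
  move=> /inj/sclassP /(_ tt)[a [h1 [h2 [n0 fgn]]]].
  by exists n0 => n n0n; have := fgn _ n0n; rewrite /= !hcomp1r !hcomp1l.
move=> [n0 fgn]; congr sh_class; apply/sclassP => -[].
by exists tt, I, I, n0 => n n0n; rewrite /= fgn.
Qed.

Lemma sh_proj_separated (F G : Sh R A X) :
  (forall l, sh_push (proj p l) F = sh_push (proj p l) G) -> F = G.
Proof.
have [f ->] := seq_class_surj F; have [g ->] := seq_class_surj G => fg.
by apply/seq_classP => l; apply/sh_push_projP.
Qed.

End sequences.

(** * The topological group structure *)

Section group.
Variables (R : realType) (k : nat) (X : ptopologicalType).
Local Notation S := (sphere R k.+1).
Hypotheses (HS : HPol R S) (HX : has_expansion R X).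
Local Notation E := (expansion_of R X).
Implicit Types f g : smor (rud_sys R S) E.

Let HE : HPol_expansion E. Proof. exact: expansion_ofP. Qed.

(** [sh_repr] picks an arbitrary representative, which at each index agrees with the given one only
    from some term on. *)
Lemma coarse_addE f g :
  coarse_add (seq_class f) (seq_class g) = seq_class (smor_add f g).
Proof.
have rep (h : smor (rud_sys R S) E) : seq_class (sh_repr (seq_class h)) = seq_class h.
  by rewrite /sh_repr; case: xgetP => [_ -> //|/(_ h)[]].
apply/(seq_classP HS HE) => l.
have /(seq_classP HS HE)/(_ l)[n1 fn] := rep f.
have /(seq_classP HS HE)/(_ l)[n2 gn] := rep g.
exists (maxn n1 n2) => n; rewrite geq_max => /andP[n1n n2n].
by rewrite /= fn// gn.
Qed.

Lemma smor_opp_subproof f (m m' : idx E) (h : ile m m') :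
  exists (l : idx (rud_sys R S)) (h1 h2 : @ile R (rud_sys R S) tt l) (n0 : nat),
    forall n : nat, (n0 <= n)%N ->
      hcomp (bond h) (hcomp (hopp (f n m')) (bond h2)) = hcomp (hopp (f n m)) (bond h1).
Proof.
have [l [h1 [h2 [n0 fP]]]] := smorP f h.
exists tt, I, I, n0 => n n0n; have := fP n n0n.
by rewrite !hcomp1r /hopp hcompA => ->.
Qed.

Definition smor_opp f : smor (rud_sys R S) E :=
  @SMor R (rud_sys R S) E (fun=> tt) (fun n m => hopp (f n m)) (@smor_opp_subproof f).

Definition coarse_opp (F : Sh R S X) : Sh R S X := seq_class (smor_opp (sh_repr F)).

Lemma coarse_oppE f : coarse_opp (seq_class f) = seq_class (smor_opp f).
Proof.
have rep : seq_class (sh_repr (seq_class f)) = seq_class f.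
  by rewrite /sh_repr; case: xgetP => [_ -> //|/(_ f)[]].
apply/(seq_classP HS HE) => l.
have /(seq_classP HS HE)/(_ l)[n0 fn] := rep.
by exists n0 => n n0n; rewrite /= fn.
Qed.

(** The base point is built on the chosen expansion of the sphere; its index and the one produced by
    the canonical isomorphism are compared at a common upper bound. *)
Lemma seq_class_point : seq_class (smor_const (rud_sys R S) E) = point.
Proof.
rewrite /seq_class /sh_class /= -/(pzero _ _).
have -> : pro_comp (pzero (rud_sys R S) E)
    (induced (expansion_of R S) (rud R S) (hid R S)) = pzero _ _.
  rewrite -[induced _ _ _]sreprK pro_compE; apply/sclassP => m /=.
  set a := inhabited_witness (idx_nonempty (expansion_of R S)); set b := sidx _ _.
  have [c [ac bc]] := ile_directed b a.
  by exists c, ac, bc, 0%N => n _; rewrite !hcomp0l.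
exact: pro_comp0r.
Qed.

(** For fixed [l] the basic sets are the classes of an equivalence relation, so a basic set
    containing [F] may be recentred at [F]. *)
Lemma nbhs_shP (F : Sh R S X) (U : set (Sh R S X)) :
  nbhs F U <-> exists l : idx E, sh_basic F l `<=` U.
Proof.
rewrite nbhsE; split.
  move=> [V [oV VF] VU]; have [G [l [Fl GV]]] := oV F VF.
  exists l => H FH; apply/VU/GV; rewrite /sh_basic/= Fl; exact: FH.
move=> [l FU]; exists (sh_basic F l) => //; split; last exact: erefl.
by move=> G FG; exists F, l; split.
Qed.

(** Sums are taken termwise, so the index [l] of the target serves for both arguments. *)
Lemma coarse_add_continuous :
  continuous (fun z : Sh R S X * Sh R S X => coarse_add z.1 z.2).
Proof.
move=> [F G] U /nbhs_shP[l FU].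
exists (sh_basic F l, sh_basic G l).
  by split; apply/nbhs_shP; exists l.
move=> [F' G'] [/= FF' GG']; apply: FU; move: FF' GG'.
have [f ->] := seq_class_surj HS HE F; have [g ->] := seq_class_surj HS HE G.
have [f' ->] := seq_class_surj HS HE F'; have [g' ->] := seq_class_surj HS HE G'.
rewrite /sh_basic /= !coarse_addE => /(sh_push_projP HS HE)[n1 fn].
move=> /(sh_push_projP HS HE)[n2 gn]; apply/(sh_push_projP HS HE).
exists (maxn n1 n2) => n; rewrite geq_max => /andP[n1n n2n].
by rewrite /= fn// gn.
Qed.

Lemma coarse_group_topological : topological_group (@coarse_add R k X).
Proof.
exists coarse_opp; split.
- move=> F G H; have [f ->] := seq_class_surj HS HE F.
  have [g ->] := seq_class_surj HS HE G; have [h ->] := seq_class_surj HS HE H.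
  rewrite !coarse_addE; apply/(seq_classP HS HE) => l.
  by exists 0%N => n _; exact: haddA.
- split=> F; have [f ->] := seq_class_surj HS HE F;
    rewrite -seq_class_point coarse_addE; apply/(seq_classP HS HE) => l;
    exists 0%N => n _; [exact: hadd0l|exact: hadd0r].
- split=> F; have [f ->] := seq_class_surj HS HE F;
    rewrite -seq_class_point coarse_oppE coarse_addE; apply/(seq_classP HS HE) => l;
    exists 0%N => n _; [exact: haddNl|exact: haddNr].
- exact: coarse_add_continuous.
- move=> F U /nbhs_shP[l FU]; apply/nbhs_shP; exists l => G FG; apply: FU.
  move: FG; have [f ->] := seq_class_surj HS HE F; have [g ->] := seq_class_surj HS HE G.
  rewrite !coarse_oppE => /(sh_push_projP HS HE)[n0 fg].
  by apply/(sh_push_projP HS HE); exists n0 => n n0n; rewrite /= fg.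
Qed.

End group.

(** * The induced systems and the finiteness of their terms *)

Lemma sh_under_movable (R : realType) (A X : ptopologicalType) (p : under R X)
    (Hp : HPol_expansion p) :
  movable_system p -> movable_system (sh_under A Hp).
Proof.
move=> mov l; have [l' [h' H]] := mov l; exists l', h' => l'' h''.
have [r rE] := H l'' h''; have [Hp' _ _] := Hp.
pose He m := HPol_has_expansion (Hp' m).
exists (hclass R (sh_ptmap A (He l') (He l'') r)).
rewrite hcompE; congr hclass; apply: ptmapP => F /=.
by rewrite -sh_push_comp ?rE//; exact: He.
Qed.

(** The identity of [Y] factors through some projection of the chosen expansion; the basic set at
    that index is a singleton. *)
Lemma sh_open_set1 (R : realType) (A Y : ptopologicalType) (F : Sh R A Y) :
  HPol R Y -> open [set F].
Proof.
move=> HY; have eY := HPol_has_expansion HY.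
have [HE E1 _] := expansion_ofP eY.
have [l [f idE]] := E1 Y HY (hid R Y).
move=> _ ->; exists F, l; split; first exact: erefl.
move=> G FG /=; rewrite -(sh_push_id F eY) -(sh_push_id G eY) idE.
have el := HPol_has_expansion (HE l).
by rewrite !(sh_push_comp _ f)//; congr (sh_push f _).
Qed.

Lemma compact_sh_finite (R : realType) (A Y : ptopologicalType) :
  HPol R Y -> compact [set: Sh R A Y] -> finite_set [set: Sh R A Y].
Proof.
move=> HY; rewrite compact_cover => /(_ _ setT set1)[|F _|D _ DT].
- by move=> F _; exact: sh_open_set1.
- by exists F.
by apply: (sub_finite_set _ (finite_fset D)) => F /DT[G DG ->].
Qed.

Section finite_sequences.
Variables (R : realType) (A Y : ptopologicalType).
Hypotheses (HA : HPol R A) (HY : HPol R Y).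

Lemma smor_seq_subproof (u : nat -> htop R A Y)
    (m m' : idx (rud_sys R Y)) (h : ile m m') :
  exists (l : idx (rud_sys R A)) (h1 h2 : @ile R (rud_sys R A) tt l) (n0 : nat),
    forall n : nat, (n0 <= n)%N ->
      hcomp (bond h) (hcomp (u n) (bond h2)) = hcomp (u n) (bond h1).
Proof. by exists tt, I, I, 0%N => n _ /=; rewrite hcomp1l. Qed.

Definition smor_seq (u : nat -> htop R A Y) : smor (rud_sys R A) (rud R Y) :=
  @SMor R (rud_sys R A) (rud R Y) (fun=> tt) (fun n _ => u n) (@smor_seq_subproof u).

(* If [A, Y] had two elements, the sequences equal to one of them exactly at the
   multiples of j + 1 would be pairwise not eventually equal. *)
Lemma finite_sh_subsingleton :
  finite_set [set: Sh R A Y] -> forall F G : Sh R A Y, F = G.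
Proof.
move=> fin; have Hr := rud_expansion HY.
have [tA|] := pselect (forall a b : htop R A Y, a = b).
  move=> F G; have [f ->] := seq_class_surj HA Hr F; have [g ->] := seq_class_surj HA Hr G.
  by apply/(seq_classP HA Hr) => l; exists 0%N => n _; exact: tA.
move=> /existsNP[a /existsNP[b ab]]; exfalso.
pose s j n := if (j.+1 %| n)%N then a else b.
pose F j := seq_class (smor_seq (s j)).
have Fneq i j : (i < j)%N -> F i <> F j.
  (* This term lies beyond [n0], is a multiple of [i.+1], and is congruent to [i.+1] modulo the
     larger [j.+1]. *)
  move=> ij /(seq_classP HA Hr)/(_ tt)[n0] /(_ (i.+1 * (1 + j.+1 * n0))%N).
  rewrite /= /s dvdn_mulr// mulnDr muln1 mulnCA dvdn_addl ?dvdn_mulr//.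
  rewrite gtnNdvd// => e; apply/ab/e.
  by rewrite (leq_trans _ (leq_addl _ _))// mulnA leq_pmull.
have Finj : injective F.
  move=> i j e; case: (ltngtP i j) => // ij; first by case: (Fneq _ _ ij).
  by case: (Fneq _ _ ij).
apply: infinite_nat; rewrite -(preimage_setT F).
by apply: finite_preimage fin => i j _ _; exact: Finj.
Qed.

End finite_sequences.

(** * Expansions by one-point spaces and the conclusion *)

Lemma htop_subsingleton (R : realType) (X P : ptopologicalType) :
  (forall x y : X, x = y) -> forall f g : htop R X P, f = g.
Proof.
move=> X1 f g; rewrite -[f]hreprK -[g]hreprK; congr hclass; apply: ptmapP => x.
by rewrite (X1 x point) !ptmap_point.
Qed.

Lemma polyhedron_HPol (R : realType) (X : ptopologicalType) : polyhedron R X -> HPol R X.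
Proof.
move=> [V [K [f [g [cf cg fK gK]]]]]; exists V, K, (f point).
have gp : g (f point) = point by rewrite fK.
exists (hclass R (@PtMap X (pointed_realization (f point)) f cf erefl)).
exists (hclass R (@PtMap (pointed_realization (f point)) X g cg gp)).
by rewrite !hcompE; split; congr hclass; apply: ptmapP => x /=.
Qed.

(** Morphisms out of a one-point space are all equal, so (E1) holds with a constant map at any index
    and (E2) already at [l]. *)
Lemma sh_under_expansion (R : realType) (A X : ptopologicalType) (p : under R X)
    (Hp : HPol_expansion p) :
  (forall l, HPol R (Sh R A (p l))) -> (forall l (F G : Sh R A (p l)), F = G) ->
  (forall F G : Sh R A X, F = G) ->
  HPol_expansion (sh_under A Hp).
Proof.
move=> HSh terms1 limit1; split => //.
  move=> P _ h; have l := inhabited_witness (idx_nonempty p).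
  by exists l, (hconst R _ P); exact: htop_subsingleton.
move=> P _ l f0 f1 _; exists l, (ile_refl l).
by apply: htop_subsingleton; exact: terms1.
Qed.

Theorem mainTheorem10 (R : realType) (X : ptopologicalType) (k : nat) :
  (movable R X ->
   forall (p : under R X) (Hp : HPol_expansion p),
     movable_system p ->
     HPol_expansion (sh_under (sphere R k.+1) Hp) ->
     movable_topological_group R (@coarse_add R k X)) /\
  (forall (p : under R X) (Hp : HPol_expansion p),
     (forall l : idx p, compact_polyhedron R (Sh R (sphere R k.+1) (p l))) ->
     HPol_expansion (sh_under (sphere R k.+1) Hp) /\
     (movable R X -> movable_topological_group R (@coarse_add R k X))).
Proof.
have HS : HPol R (sphere R k.+1) by exact/polyhedron_HPol/sphere_polyhedron.
split.
  move=> _ p Hp mov HSh; split.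
    by apply: coarse_group_topological => //; exists p.
  by exists (sh_under (sphere R k.+1) Hp); split => //; exact: sh_under_movable.
move=> p Hp cp; have [Hp' _ _] := Hp.
have terms1 l (F G : Sh R (sphere R k.+1) (p l)) : F = G.
  have [_ cl] := cp l.
  exact: (finite_sh_subsingleton HS (Hp' l) (compact_sh_finite (Hp' l) cl)).
have limit1 (F G : Sh R (sphere R k.+1) X) : F = G.
  by apply: (sh_proj_separated HS Hp) => l; exact: terms1.
have HSh : HPol_expansion (sh_under (sphere R k.+1) Hp).
  by apply: sh_under_expansion => // l; apply: polyhedron_HPol; case: (cp l).
split=> // _; split.
  by apply: coarse_group_topological => //; exists p.
exists (sh_under (sphere R k.+1) Hp); split=> // l.
(* All terms are points, so any two morphisms between them agree and [l' = l] works. *)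
exists l, (ile_refl l) => l'' h''; exists (hconst R _ _).
by apply: htop_subsingleton; exact: terms1.
Qed.
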